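(* Let $\Gamma=\Gamma_2$, and let $u\in LSC(B_1\setminus\{0\})\cap L_{loc}^{\infty}(B_1\setminus\{0\})$ be a viscosity supersolution, i.e. satisfy $\lambda(A^u)\in\bar\Gamma$ in $B_1\setminus\{0\}$ in the viscosity sense. Then either $u$ can be extended to a function in $C_{loc}^{0,1}(B_1)$, or $u=-4\ln |x|+C$ for some constant $C$, and $A^u=0$. Moreover, in the former case, there holds $$\|w\|_{C^{0,1}(B_{1/2})}\leq C(\Gamma)\max_{\partial B_{3/4}}w,$$ where $w=e^{-u/4}$ and $C(\Gamma)$ is a constant depending only on $\Gamma$.
   Context: $B_r$ is the open ball of radius $r$ centered at the origin in $\mathbb{R}^2$. $\Gamma_2=\{(\lambda_1,\lambda_2)\in\mathbb{R}^2:\lambda_1>0,\lambda_2>0\}$. For a $C^2$ function $u$ on an open subset of $\mathbb{R}^2$, $$A^u=-\frac{\nabla^2u}{e^u}+\frac{1}{2}\frac{du\otimes du}{e^u}-\frac{1}{4}\frac{|\nabla u|^2}{e^u}I,$$ and $\lambda(A^u)$ denotes the eigenvalues of the symmetric matrix $A^u$. For $S\subset\mathbb{R}^2$, $LSC(S)$ is the set of functions $u:S\to\mathbb{R}\cup\{+\infty\}$, $u\not\equiv+\infty$, with $\liminf_{x\to x_0}u(x)\ge u(x_0)$ for all $x_0\in S$. For $\Omega\subset\mathbb{R}^2$ open, $u\in LSC(\Omega)$ satisfies $\lambda(A^u)\in\bar\Gamma$ in $\Omega$ in the viscosity sense (equivalently, is a viscosity supersolution of $\lambda(A^u)\in\partial\Gamma$)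 if for any $x_0\in\Omega$ and $\varphi\in C^2(\Omega)$ with $(u-\varphi)(x_0)=0$ and $u-\varphi\ge 0$ near $x_0$, one has $\lambda(A^\varphi(x_0))\in\bar\Gamma$. *)

(* Defs.v *)
From HB Require Import structures.
From mathcomp Require Import all_boot all_order all_algebra.
From mathcomp Require Import all_classical all_reals all_analysis measurable_realfun.
Set Implicit Arguments.
Unset Strict Implicit.
Unset Printing Implicit Defensive.
Import Order.TTheory GRing.Theory Num.Theory.
Import numFieldNormedType.Exports.
Local Open Scope classical_set_scope.
Local Open Scope ring_scope.

Section plane.
Context {R : realType}.
Implicit Types (x v : R * R) (S D Omega Gamma : set (R * R)).

(* The canonical norm of the product [R * R] is the sup norm; the Euclidean
   norm, which induces the same topology, is the one used throughout. *)
Definition enorm x : R := Num.sqrt (x.1 ^+ 2 + x.2 ^+ 2).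

Definition eball (r : R) : set (R * R) := [set x | enorm x < r].

Definition esphere (r : R) : set (R * R) := [set x | enorm x = r].

Definition punctured_disc : set (R * R) := eball 1 `\ 0.

Definition basis2 (i : 'I_2) : R * R := if i == 0 then (1, 0) else (0, 1).

(* [Ck_on k Omega f]: all partial derivatives of [f] of order at most [k] exist
   and are continuous on the open set [Omega]. *)
Fixpoint Ck_on (k : nat) Omega (f : R * R -> R) : Prop :=
  (forall x, Omega x -> {for x, continuous f}) /\
  if k is k'.+1 then
    forall i : 'I_2, (forall x, Omega x -> derivable f x (basis2 i)) /\
                     Ck_on k' Omega ('D_(basis2 i) f)
  else True.

Definition grad (f : R * R -> R) x : 'rV[R]_2 := \row_i 'D_(basis2 i) f x.

Definition hess (f : R * R -> R) x : 'M[R]_2 :=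
  \matrix_(i, j) 'D_(basis2 i) ('D_(basis2 j) f) x.

Definition sqnorm (p : 'rV[R]_2) : R := \sum_i p 0 i ^+ 2.

Definition conf_hess (f : R * R -> R) x : 'M[R]_2 :=
  - ((expR (f x))^-1 *: hess f x)
  + (2^-1 / expR (f x)) *: ((grad f x)^T *m grad f x)
  - (4^-1 * (sqnorm (grad f x) / expR (f x))) *: 1%:M.

(* [l] lists the eigenvalues of [A] with multiplicity.  For symmetric [A] it
   exists and is unique up to order; [eigenvalues_in] is meant for a [Gamma]
   which is invariant under exchanging the coordinates. *)
Definition is_spectrum (A : 'M[R]_2) (l : R * R) : Prop :=
  char_poly A = ('X - l.1%:P) * ('X - l.2%:P).

Definition eigenvalues_in (A : 'M[R]_2) Gamma : Prop :=
  exists2 l, is_spectrum A l & Gamma l.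

Definition Gamma2 : set (R * R) := [set l | 0 < l.1 /\ 0 < l.2].

(* Functions on [S] are represented by total functions whose values outside
   [S] are irrelevant. *)
Definition LSC S (u : R * R -> \bar R) : Prop :=
  [/\ forall x, S x -> u x != -oo%E,
      exists2 x, S x & u x != +oo%E &
      forall x0, S x0 -> (u x0 <= limf_einf u (within S x0^'))%E].

Definition lebesgue2 := ((@lebesgue_measure R) \x (@lebesgue_measure R))%E.

Definition Linfty_loc Omega (u : R * R -> \bar R) : Prop :=
  measurable_fun Omega u /\
  forall K : set (R * R), compact K -> K `<=` Omega ->
    exists M : R, {ae lebesgue2, forall x, K x -> (`|u x| <= M%:E)%E}.

Definition visc_supersol Gamma Omega (u : R * R -> \bar R) : Prop :=
  forall (x0 : R * R) (phi : R * R -> R),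
    Omega x0 -> Ck_on 2 Omega phi ->
    u x0 = (phi x0)%:E -> (\forall x \near x0, ((phi x)%:E <= u x)%E) ->
    eigenvalues_in (conf_hess phi x0) (closure Gamma).

(* The diagonal terms of the difference quotient are [0 / 0 = 0]. *)
Definition C01_norm D (f : R * R -> R) : \bar R :=
  (ereal_sup [set `|f x|%:E | x in D] +
   ereal_sup [set (`|f z.1 - f z.2| / enorm (z.1 - z.2))%:E | z in D `*` D])%E.

Definition C01_loc Omega (f : R * R -> R) : Prop :=
  forall K : set (R * R), compact K -> K `<=` Omega -> (C01_norm K f < +oo)%E.

Definition C01_extension (u : R * R -> \bar R) (v : R * R -> R) : Prop :=
  C01_loc (eball 1) v /\ forall x, punctured_disc x -> u x = (v x)%:E.

End plane.

(* Main.v *)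
Require Import Defs.
From HB Require Import structures.
From mathcomp Require Import all_boot all_order all_algebra.
From mathcomp Require Import all_classical all_reals all_analysis measurable_realfun.
From mathcomp Require Import ring lra.
Import Order.TTheory GRing.Theory Num.Theory.
Import numFieldNormedType.Exports.
Local Open Scope classical_set_scope.
Local Open Scope ring_scope.

(** Put w = exp(-u/4) and h = w^2 = exp(-u/2).  A computation gives
      A^u = (2 / (e^u h^2)) (h D^2 h - |Dh|^2 I / 2),
    so the hypothesis says, in the viscosity sense, that h D^2 h >= |Dh|^2 I / 2.
    The extremal functions are h(x) = c |x - x0|^2 and the constants, and the
    inequality is invariant under Moebius transformations.

    The heart of the proof is a comparison principle along circles and lines
    ([conic_comparison]).  Let g and P be real combinations of 1, x_1, x_2 and
    |x|^2, orthogonal for the Lorentzian form that polarizes the discriminant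
    |b|^2 - 4 a c, and let both have positive discriminant.  If P > 0 on an arc
    of {g = 0} and h < P at its ends, then h <= P on the arc.  The proof is to
    touch h from above by a multiple of P + N g^2, with N large: at the contact
    point, the viscosity inequality tested along the level curve of g fails, by
    an exact algebraic identity.  All test functions are polynomials.  On a line
    this gives convexity of w ([profile_convex_off0]); on a circle through the
    origin it gives, in the inverted variable y = x / |x|^2, a comparison of
    |y|^2 h with affine functions along a straight line.

    Convexity of w on chords that miss the origin bounds w by its maximum over
    a circle and makes it Lipschitz up to the origin, with the explicit constant
    of [lipschitz_punctured]: a difference quotient is at most the slope up to
    an outer circle.  This is the estimate of the theorem, with K = 1 + 4.

    Hence w has a limit w0 >= 0 at the origin.  If w0 > 0, then u = -4 ln w is
    locally Lipschitz.  If w0 = 0, then h <= L |x|^2, so that h / |x|^2 is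
    bounded; in the variable y it is a function below its affine interpolations
    on every line outside the unit disc, and a bounded function of this kind on
    a whole line is constant ([circle_const]).  Any two such lines that are not
    parallel meet, so h / |x|^2 is constant and u = -4 ln |x| + C
    ([radial_of_linear_bound]). *)

(** * Polynomial functions on the plane *)

Section polynomials.
Context {R : realType}.
Implicit Types (x v : R * R).

(** Test functions must be of class C^2 on the whole domain.  For polynomials
    given by syntax the partial derivatives are computed by [pderiv], and all
    regularity follows at once. *)
Inductive polyexpr :=
  Cst of R | Var1 | Var2 | Add of polyexpr & polyexpr | Mul of polyexpr & polyexpr.

Fixpoint peval (P : polyexpr) x : R :=
  match P with
  | Cst c => c | Var1 => x.1 | Var2 => x.2
  | Add P Q => peval P x + peval Q x | Mul P Q => peval P x * peval Q x end.

Fixpoint pderiv (i : 'I_2) (P : polyexpr) : polyexpr :=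
  match P with
  | Cst c => Cst 0
  | Var1 => Cst (basis2 i).1 | Var2 => Cst (basis2 i).2
  | Add P Q => Add (pderiv i P) (pderiv i Q)
  | Mul P Q => Add (Mul (pderiv i P) Q) (Mul P (pderiv i Q)) end.

Lemma continuous_fst : continuous (fst : R * R -> R).
Proof. by move=> x; exact: cvg_fst. Qed.

Lemma continuous_snd : continuous (snd : R * R -> R).
Proof. by move=> x; exact: cvg_snd. Qed.

Lemma continuous_peval P : continuous (peval P).
Proof.
elim: P => [c|||P IP Q IQ|P IP Q IQ] x.
- exact: cvg_cst.
- exact: continuous_fst.
- exact: continuous_snd.
- exact: cvgD (IP x) (IQ x).
- exact: cvgM (IP x) (IQ x).
Qed.

Lemma near_peval_lt P x a : peval P x < a -> \forall y \near x, peval P y < a.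
Proof. by move=> Pa; exact: (cvgr_lt _ (continuous_peval P x) _ Pa). Qed.

Lemma near_peval_gt P x a : a < peval P x -> \forall y \near x, a < peval P y.
Proof. by move=> Pa; exact: (cvgr_gt _ (continuous_peval P x) _ Pa). Qed.

Lemma is_derive_linear (f : {linear (R * R)%type -> R}) x v : continuous f ->
  is_derive x v f (f v).
Proof.
move=> cf; have df := linear_differentiable x cf.
by apply: DeriveDef; [exact: diff_derivable|rewrite deriveE // diff_lin].
Qed.

Lemma is_derive_peval P i x : is_derive x (basis2 i) (peval P) (peval (pderiv i P) x).
Proof.
elim: P => [c|||P IP Q IQ|P IP Q IQ] /=.
- exact: is_derive_cst.
- exact: (is_derive_linear (GRing.Linear.clone _ _ _ _ (fst : R * R -> R) _)) continuous_fst.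
- exact: (is_derive_linear (GRing.Linear.clone _ _ _ _ (snd : R * R -> R) _)) continuous_snd.
- exact: is_deriveD.
- rewrite (_ : _ + _ = peval P x *: peval (pderiv i Q) x + peval Q x *: peval (pderiv i P) x).
    exact: (is_deriveM IP IQ).
  by rewrite /GRing.scale /= addrC [X in _ + X = _]mulrC.
Qed.

Lemma derive_peval P i x : 'D_(basis2 i) (peval P) x = peval (pderiv i P) x.
Proof. by have [_ ->] := is_derive_peval P i x. Qed.

Lemma derive_pevalf P i : 'D_(basis2 i) (peval P) = peval (pderiv i P).
Proof. by apply/funext => x; exact: derive_peval. Qed.

Lemma Ck_on_peval k (Omega : set (R * R)) P : Ck_on k Omega (peval P).
Proof.
elim: k P => [|k IH] P; split => //.
- by move=> x _; exact: continuous_peval.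
- by move=> x _; exact: continuous_peval.
- move=> i; split; last by rewrite derive_pevalf; exact: IH.
  by move=> x _; have [] := is_derive_peval P i x.
Qed.

(** This is what makes the conformal Hessian of a polynomial symmetric. *)
Lemma pderivC P i j x : peval (pderiv i (pderiv j P)) x = peval (pderiv j (pderiv i P)) x.
Proof.
elim: P => [c|||P IP Q IQ|P IP Q IQ] //=; first by rewrite IP IQ.
by rewrite IP IQ; ring.
Qed.

Lemma conf_hess_peval P x i j : conf_hess (peval P) x i j =
  (expR (peval P x))^-1 * (- peval (pderiv i (pderiv j P)) x
    + 2^-1 * (peval (pderiv i P) x * peval (pderiv j P) x)
    - 4^-1 * (peval (pderiv 0 P) x ^+ 2 + peval (pderiv 1 P) x ^+ 2) * (i == j)%:R).
Proof.
rewrite /conf_hess /hess /grad /sqnorm !mxE big_ord1 !mxE.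
rewrite big_ord_recl big_ord1 !mxE derive_pevalf !derive_peval.
rewrite (_ : lift ord0 ord0 = 1); last exact/val_inj.
by field; rewrite gt_eqF ?expR_gt0.
Qed.

End polynomials.
Arguments polyexpr : clear implicits.
Arguments near_peval_lt {R} P [x a].
Arguments near_peval_gt {R} P [x a].
Arguments Var1 {R}.
Arguments Var2 {R}.


(** * The viscosity inequality tested by polynomials *)

Section viscosity_test.
Context {R : realType}.
Implicit Types (x : R * R) (s : R).

(** The right-hand side is the Taylor polynomial of ln at 1, and the derivative
    of the difference is (s - 1)^3 / s.  A bound valid for every s > 0 is what
    lets a polynomial touch u from below. *)
Lemma ln_le_cubic s : 0 < s ->
  ln s <= (s - 1) - (s - 1) ^+ 2 / 2 + (s - 1) ^+ 3 / 3.
Proof.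
move=> s0.
pose F := fun y : R => (y - 1) - (y - 1) ^+ 2 / 2 + (y - 1) ^+ 3 / 3 - ln y.
have dF (y : R) : 0 < y -> is_derive y 1 F ((y - 1) ^+ 3 / y).
  move=> y0; have dln := is_derive1_ln y0.
  rewrite /F; apply: is_derive_eq; rewrite /GRing.scale /=.
  by field; rewrite gt_eqF.
have cF (a b : R) : 0 < a -> {within `[a, b], continuous F}.
  move=> a0; apply: derivable_within_continuous => y.
  rewrite in_itv /= => /andP[ay _].
  by have [] := dF y (lt_le_trans a0 ay).
have F1 : F 1 = 0 by rewrite /F ln1; ring.
suff : 0 <= F s by rewrite /F subr_ge0.
have [s1|s1|->] := ltrgtP s 1; last by rewrite F1.
- have [y|y] := MVT s1 (df := fun y => (y - 1) ^+ 3 / y) _ (cF s 1 s0).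
    by rewrite in_itv /= => /andP[sy _]; exact: dF (lt_trans s0 sy).
  rewrite in_itv /= => /andP[sy y1]; rewrite F1 sub0r => eF.
  rewrite -oppr_le0 eF mulrAC mulr_le0_ge0 ?invr_ge0 ?(ltW (lt_trans s0 sy)) //.
  rewrite mulr_le0_ge0 ?subr_ge0 ?(ltW s1) //.
  by rewrite exprS mulr_le0_ge0 ?sqr_ge0 // subr_le0 ltW.
- have [y|y] := MVT s1 (df := fun y => (y - 1) ^+ 3 / y) _ (cF 1 s ltr01).
    by rewrite in_itv /= => /andP[sy _]; exact: dF (lt_trans ltr01 sy).
  rewrite in_itv /= => /andP[y1 ys]; rewrite F1 subr0 => ->.
  rewrite mulr_ge0 ?subr_ge0 ?(ltW s1) // divr_ge0 ?(ltW (lt_trans _ y1)) //.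
  by rewrite exprn_ge0 // subr_ge0 ltW.
Qed.

Lemma closure_Gamma2 (l : R * R) :
  closure Gamma2 l -> 0 <= l.1 /\ 0 <= l.2.
Proof.
move=> cl; split; rewrite leNgt; apply/negP => l0.
- have /cl[m [[m1 _]]] : nbhs l [set m : R * R | m.1 < 0].
    exact: (near_peval_lt Var1 l0).
  by rewrite /= ltNge (ltW m1).
- have /cl[m [[_ m1]]] : nbhs l [set m : R * R | m.2 < 0].
    exact: (near_peval_lt Var2 l0).
  by rewrite /= ltNge (ltW m1).
Qed.

(** Nonnegative eigenvalues give a nonnegative trace and determinant, which in
    dimension two characterize positive semidefinite symmetric matrices. *)
Lemma psd_of_eigenvalues_in (A : 'M[R]_2) (e : R * R) :
  A 0 1 = A 1 0 -> eigenvalues_in A (closure Gamma2) ->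
  0 <= A 0 0 * e.1 ^+ 2 + 2 * A 0 1 * e.1 * e.2 + A 1 1 * e.2 ^+ 2.
Proof.
move=> As [l sp /closure_Gamma2[l1 l2]].
have trA : A 0 0 + A 1 1 = l.1 + l.2.
  have := char_poly_trace A isT.
  rewrite sp /mxtrace big_ord_recl big_ord1 coefM.
  rewrite big_ord_recl big_ord1 /= !coefB !coefX !coefC /=.
  rewrite (_ : lift ord0 ord0 = 1); last exact/val_inj.
  move=> h; apply: oppr_inj; rewrite -h; ring.
have dtA : A 0 0 * A 1 1 - A 0 1 ^+ 2 = l.1 * l.2.
  have := char_poly_det A.
  rewrite sp (expand_det_row _ 0) coefM big_ord1 /= !coefB !coefX !coefC /=.
  rewrite big_ord_recl big_ord1 /cofactor !det_mx11 !mxE /=.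
  rewrite (_ : lift ord0 ord0 = 1); last exact/val_inj.
  rewrite (_ : lift 1 0 = 0); last exact/val_inj.
  rewrite -As => h.
  transitivity ((0 - l.1) * (0 - l.2)); last by ring.
  rewrite h (_ : (ord0 : 'I_2) = 0) // /bump /=.
  have det2 (a b c : R) : a * c - b ^+ 2 =
      (-1) ^+ 2 * (a * ((-1) ^+ (0 + 0) * c) + b * ((-1) ^+ (0 + 1) * b)) by ring.
  exact: det2.
have t0 : 0 <= A 0 0 + A 1 1 by rewrite trA addr_ge0.
have d0 : A 0 1 ^+ 2 <= A 0 0 * A 1 1 by rewrite -subr_ge0 dtA mulr_ge0.
move: (A 0 0) (A 0 1) (A 1 1) t0 d0 => a b c t0 d0.
have b0 := sqr_ge0 b.
have a0 : 0 <= a by nra.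
have c0 : 0 <= c by nra.
have [a1|a1|a1] := ltrgtP 0 a; last 2 first.
- by move: a1; rewrite ltNge a0.
- have b1 : b = 0 by apply/eqP; rewrite -sqrf_eq0 eq_le b0 andbT -a1 mul0r in d0 *.
  by rewrite b1 -a1; have := sqr_ge0 e.2; nra.
rewrite -(pmulr_rge0 _ a1).
rewrite (_ : a * (_ + _) = (a * e.1 + b * e.2) ^+ 2 + (a * c - b ^+ 2) * e.2 ^+ 2);
  last by ring.
by rewrite addr_ge0 ?sqr_ge0 // mulr_ge0 ?sqr_ge0 // subr_ge0.
Qed.

Definition pscale (c : R) (P : polyexpr R) := Mul (Cst c) P.

(** If exp(-u/2) is touched from above by a positive polynomial H, then
    -2 ln H touches u from below but need not be defined on all of Omega.
    The cubic Taylor polynomial of -2 ln, composed with H / H(x0), lies below it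
    and has the same second order jet at x0. *)
Lemma polynomial_test (Omega : set (R * R)) (u : R * R -> \bar R)
    (H : polyexpr R) x0 (e : R * R) :
  visc_supersol Gamma2 Omega u -> Omega x0 -> 0 < peval H x0 ->
  u x0 = (- 2 * ln (peval H x0))%:E ->
  (\forall x \near x0, ((- 2 * ln (peval H x))%:E <= u x)%E) ->
  0 <= peval H x0 * (peval (pderiv 0 (pderiv 0 H)) x0 * e.1 ^+ 2
                  + 2 * peval (pderiv 0 (pderiv 1 H)) x0 * e.1 * e.2
                  + peval (pderiv 1 (pderiv 1 H)) x0 * e.2 ^+ 2)
       - 2^-1 * (peval (pderiv 0 H) x0 ^+ 2 + peval (pderiv 1 H) x0 ^+ 2)
              * (e.1 ^+ 2 + e.2 ^+ 2).
Proof.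
move=> usup Ox0 H0 ux0 ule.
have H0' : peval H x0 != 0 by rewrite gt_eqF.
pose T := Add (pscale (peval H x0)^-1 H) (Cst (- 1)).
pose phi := Add (Cst (- 2 * ln (peval H x0)))
  (Add (pscale (- 2) T) (Add (Mul T T) (pscale (- (2 / 3)) (Mul T (Mul T T))))).
have T0 : (peval H x0)^-1 * peval H x0 + - 1 = 0 by field.
have phix0 : peval phi x0 = - 2 * ln (peval H x0) by rewrite /= T0; ring.
have := usup x0 (peval phi) Ox0 (Ck_on_peval 2 Omega phi).
rewrite phix0 => /(_ ux0) hA.
have /hA {}hA : \forall x \near x0, ((peval phi x)%:E <= u x)%E.
  have Hp := near_peval_gt _ H0.
  near=> x.
  have Hx : 0 < peval H x by near: x.
  have : ((- 2 * ln (peval H x))%:E <= u x)%E by near: x.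
  apply: le_trans; rewrite lee_fin.
  have q0 : 0 < (peval H x0)^-1 * peval H x by rewrite mulr_gt0 ?invr_gt0.
  have := ln_le_cubic _ q0; rewrite lnM ?posrE ?invr_gt0 // lnV ?posrE //=.
  lra.
have sA : conf_hess (peval phi) x0 0 1 = conf_hess (peval phi) x0 1 0.
  by rewrite !conf_hess_peval pderivC; ring.
have := psd_of_eigenvalues_in _ e sA hA.
rewrite !conf_hess_peval /= !T0.
set E := expR _.
have E0 : 0 < E by exact: expR_gt0.
set Hx := peval (pderiv 0 H) x0; set Hy := peval (pderiv 1 H) x0.
set Hxx := peval (pderiv 0 (pderiv 0 H)) x0; set Hxy := peval (pderiv 0 (pderiv 1 H)) x0.
set Hyy := peval (pderiv 1 (pderiv 1 H)) x0.
set h := peval H x0 in H0 H0' *.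
move=> hq.
have k0 : 0 < 2 / (E * h ^+ 2) by rewrite divr_gt0 // mulr_gt0 // exprn_gt0.
rewrite -(pmulr_rge0 _ k0).
have eq_ge0 (a b : R) : a = b -> 0 <= a -> 0 <= b by move->.
apply: eq_ge0 hq; field.
by rewrite H0' gt_eqF.
Unshelve. all: by end_near. Qed.
End viscosity_test.

(** * Semicontinuous functions *)

Section semicontinuity.
Context {R : realType}.

(** The superlevel sets {F >= F y} generate a filter because they are nested;
    a cluster point of it is a maximum. *)
Lemma usc_argmax (T : topologicalType) (A : set T) (F : T -> R) :
  compact A -> A !=set0 ->
  (forall x t, A x -> F x < t -> \forall y \near x, A y -> F y < t) ->
  exists2 x, A x & forall y, A y -> F y <= F x.
Proof.
move=> cA [a0 Aa0] uscF.
pose f y := [set x | A x /\ F y <= F x].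
pose G := [set B : set T | exists2 y, A y & f y `<=` B].
have FG : ProperFilter G.
  apply: Build_ProperFilter_ex => [B [y Ay yB]|].
    by exists y; apply: yB; split.
  split=> [|B C [y Ay yB] [z Az zC]|B C BC [y Ay yB]].
  - by exists a0.
  - have [yz|/ltW zy] := leP (F y) (F z).
      exists z => // x [Ax zx]; split; last exact: zC.
      by apply: yB; split=> //; exact: le_trans zx.
    exists y => // x [Ax yx]; split; first exact: yB.
    by apply: zC; split=> //; exact: le_trans yx.
  - by exists y => // x /yB /BC.
have [|x [Ax clx]] := cA G FG; first by exists a0 => // x [].
exists x => // y Ay; rewrite leNgt; apply/negP => /(uscF _ _ Ax) near_lt.
have [|z [[Az yz] /(_ Az)]] := clx (f y) _ _ near_lt; first by exists y.
by rewrite ltNge yz.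
Qed.

(** Otherwise the sets {f >= N q} generate a filter; at a cluster point the
    boundedness of f forces q = 0, hence f < 0 nearby, whereas f >= 0 on
    these sets. *)
Lemma penalization (T : topologicalType) (C : set T) (f q : T -> R) (M : R) :
  compact C -> (forall x, C x -> f x <= M) -> (forall x, C x -> 0 <= q x) ->
  (forall x t, C x -> f x < t -> \forall y \near x, C y -> f y < t) ->
  (forall x t, C x -> t < q x -> \forall y \near x, C y -> t < q y) ->
  (forall x, C x -> q x = 0 -> f x < 0) ->
  exists N : R, forall x, C x -> f x < N * q x.
Proof.
move=> cC fM q0 uscf lscq neg; apply: contrapT => /forallNP noN.
pose A N := [set x | C x /\ N * q x <= f x].
have A0 N : A N !=set0.
  have /existsNP[x /not_implyP[Cx /negP]] := noN N.
  by rewrite -leNgt => Nx; exists x.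
have Amono N N' : N <= N' -> A N' `<=` A N.
  move=> NN' x [Cx fx]; split => //; apply: le_trans fx.
  by rewrite ler_wpM2r // q0.
pose G := [set B : set T | exists N, A N `<=` B].
have FG : ProperFilter G.
  apply: Build_ProperFilter_ex => [B [N NB]|].
    by have [x Nx] := A0 N; exists x; exact: NB.
  split=> [|B D [N NB] [N' ND]|B D BD [N NB]].
  - by exists 0.
  - exists (Num.max N N') => x Ax; split; [apply: NB|apply: ND];
      by apply: Amono Ax; rewrite le_max lexx ?orbT.
  - by exists N; exact: subset_trans NB BD.
have [|x [Cx clx]] := cC G FG; first by exists 0 => x [].
have [qx|qx] := eqVneq (q x) 0.
  have /clx near_neg := uscf x 0 Cx (neg x Cx qx).
  have [|y [[Cy fy] /(_ Cy)]] := near_neg (A 0); first by exists 0.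
  by rewrite ltNge -(mul0r (q y)) fy.
have qx0 : 0 < q x by rewrite lt0r qx q0.
have /clx near_pos : \forall y \near x, C y -> q x / 2 < q y.
  by apply: lscq => //; rewrite ltr_pdivrMr // ltr_pMr // ltr1n.
pose N := (`|M| + 1) / (q x / 2).
have N0 : 0 < N by rewrite divr_gt0 ?divr_gt0 // ltr_wpDl.
have [|y [[Cy fy] /(_ Cy) qy]] := near_pos (A N); first by exists N.
have : N * (q x / 2) < N * q y by rewrite ltr_pM2l.
rewrite {1}/N divfK ?gt_eqF ?divr_gt0 // => lt1.
by have := ler_norm M; have := fM y Cy; lra.
Qed.

Lemma LSC_near (S : set (R * R)) (u : R * R -> \bar R) x0 (t : \bar R) :
  LSC S u -> S x0 -> (t < u x0)%E -> \forall x \near x0, S x -> (t < u x)%E.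
Proof.
move=> [_ _ /(_ x0) lscu] Sx0 tu.
have := lt_le_trans tu (lscu Sx0); rewrite limf_einfE.
move=> /ereal_sup_gt[_ [V VF <-]] tV.
have hV : \forall x \near x0, x != x0 -> S x -> V x by exact: VF.
near=> x => Sx.
have [->//|xx0] := eqVneq x x0.
apply: (lt_le_trans tV); apply: ereal_inf_lbound; exists x => //.
by have := Sx; have := xx0; near: x.
Unshelve. all: by end_near. Qed.

Lemma box_not_negligible (a b c d : R) : a < b -> c < d ->
  ~ (@lebesgue2 R).-negligible (`]a, b[ `*` `]c, d[).
Proof.
move=> ab cd [N [mN N0 subN]].
have mB : measurable (`]a, b[%classic `*` `]c, d[%classic : set (R * R)).
  by apply: measurableX; exact: measurable_itv.
suff : (0 < lebesgue2 (`]a, b[%classic `*` `]c, d[%classic : set (R * R)))%E.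
  rewrite ltNge -N0 => /negP; apply.
  by apply: le_measure; rewrite ?inE.
rewrite /lebesgue2 product_measure1E; try exact: measurable_itv.
have mitv (s t : R) : s < t -> lebesgue_measure (`]s, t[%classic : set R) = (t - s)%:E.
  by move=> st; rewrite lebesgue_measure_itv /= lte_fin st EFinB.
rewrite [X in (0 < X * _)%E]mitv // [X in (0 < _ * X)%E]mitv // -EFinM lte_fin.
by rewrite mulr_gt0 // subr_gt0.
Qed.

Lemma nbhs_box (x : R * R) (A : set (R * R)) : nbhs x A ->
  exists2 r : R, 0 < r & 
   `[x.1 - r, x.1 + r] `*` `[x.2 - r, x.2 + r] `<=` A.
Proof.
move=> /nbhs_ballP[r /= r0 hr]; exists (r / 2); first by rewrite divr_gt0.
move=> y [/=]; rewrite !in_itv /= => /andP[y1 y2] /andP[y3 y4].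
apply: hr; split; rewrite /ball /= ltr_norml; apply/andP; split; lra.
Qed.

(** A value u x0 above an essential bound M on a neighbourhood of x0 would
    force u > M on a smaller neighbourhood, which has positive measure. *)
Lemma LSC_lt_pinfty (S : set (R * R)) (u : R * R -> \bar R) x0 :
  open S -> LSC S u -> Linfty_loc S u -> S x0 -> (u x0 < +oo)%E.
Proof.
move=> oS lscu [_ Lu] Sx0; rewrite ltey; apply/eqP => ux0.
have [r r0 hr] := nbhs_box x0 S (open_nbhs_nbhs (conj oS Sx0)).
have [|M hM] := Lu _ _ hr.
  by apply: compact_setX; exact: segment_compact.
have /nbhs_box[q q0 hq] : \forall x \near x0, S x -> (M%:E < u x)%E.
  by apply: LSC_near => //; rewrite ux0 ltry.
pose m := Num.min r q.
have m0 : 0 < m by rewrite lt_min r0.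
have [mr mq] : m <= r /\ m <= q by rewrite !ge_min !lexx orbT.
have nB := box_not_negligible (x0.1 - m) (x0.1 + m) (x0.2 - m) (x0.2 + m).
apply: nB; [lra|lra|].
apply: negligibleS hM => x [/=]; rewrite !in_itv /= => /andP[x1 x2] /andP[x3 x4].
have xr : (`[x0.1 - r, x0.1 + r] `*` `[x0.2 - r, x0.2 + r]) x.
  by split => /=; rewrite in_itv /=; apply/andP; split; lra.
have xq : (`[x0.1 - q, x0.1 + q] `*` `[x0.2 - q, x0.2 + q]) x.
  by split => /=; rewrite in_itv /=; apply/andP; split; lra.
move=> /(_ xr); apply/negP; rewrite -ltNge.
exact: lt_le_trans (hq _ xq (hr _ xr)) (lee_abs _).
Qed.

End semicontinuity.

(** * The Euclidean norm and the punctured disc *)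

Section euclidean_norm.
Context {R : realType}.
Implicit Types (x y : R * R) (P k : polyexpr R).

Definition enorm2 x : R := x.1 ^+ 2 + x.2 ^+ 2.

Definition quadric (a b1 b2 c : R) : polyexpr R :=
  Add (Cst a) (Add (Add (pscale b1 Var1) (pscale b2 Var2))
                   (pscale c (Add (Mul Var1 Var1) (Mul Var2 Var2)))).

Lemma enorm2_ge0 x : 0 <= enorm2 x.
Proof. by rewrite addr_ge0 ?sqr_ge0. Qed.

Lemma enorm2_eq0 x : enorm2 x = 0 -> x = 0.
Proof.
move=> /eqP; rewrite paddr_eq0 ?sqr_ge0 // !sqrf_eq0.
by case: x => x1 x2 /= /andP[/eqP -> /eqP ->].
Qed.

Lemma enorm2_gt0 x : x != 0 -> 0 < enorm2 x.
Proof.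
by move=> x0; rewrite lt0r enorm2_ge0 andbT; apply: contra_neq x0; exact: enorm2_eq0.
Qed.

Lemma enorm_ge0 x : 0 <= enorm x.
Proof. exact: sqrtr_ge0. Qed.

Lemma enorm_sqr x : enorm x ^+ 2 = enorm2 x.
Proof. by rewrite sqr_sqrtr // enorm2_ge0. Qed.

Lemma punctured_discE x : punctured_disc x <-> 0 < enorm2 x < 1.
Proof.
have ltE : (enorm x < 1) = (enorm2 x < 1).
  by rewrite -enorm_sqr -[X in _ = (_ < X)](expr1n _ 2) ltr_sqr ?nnegrE ?enorm_ge0.
rewrite /punctured_disc /eball; split=> [[/= + /eqP x0]|/andP[x0 x1]].
  by rewrite ltE => ->; rewrite enorm2_gt0.
split; first by rewrite /= ltE.
by move=> /= /eqP; apply/negP; apply: contraTneq x0 => ->; rewrite /enorm2 !expr0n addr0 ltxx.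
Qed.

Definition enorm2p : polyexpr R := Add (Mul Var1 Var1) (Mul Var2 Var2).

Lemma peval_enorm2p x : peval enorm2p x = enorm2 x.
Proof. by rewrite /= /enorm2 !expr2. Qed.

Lemma open_punctured_disc : open (@punctured_disc R).
Proof.
rewrite openE => x /punctured_discE; rewrite -peval_enorm2p => /andP[x0 x1].
rewrite /interior; near=> y; apply/punctured_discE; rewrite -peval_enorm2p.
apply/andP; split; near: y; [exact: near_peval_gt|exact: near_peval_lt].
Unshelve. all: by end_near. Qed.

Lemma closed_peval_ge P a : closed [set x | a <= peval P x].
Proof.
move=> x clx /=; rewrite leNgt; apply/negP => /(near_peval_lt P)/clx[y [/= ay]].
by rewrite ltNge ay.
Qed.

Lemma closed_peval_le P a : closed [set x | peval P x <= a].
Proof.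
move=> x clx /=; rewrite leNgt; apply/negP => /(near_peval_gt P)/clx[y [/= ay]].
by rewrite ltNge ay.
Qed.

Lemma compact_subdisc (A : set (R * R)) :
  closed A -> (forall x, A x -> enorm2 x <= 1) -> compact A.
Proof.
move=> cA A1; apply: (@subclosed_compact _ A (`[-1, 1] `*` `[-1, 1])) => //.
  by apply: compact_setX; exact: segment_compact.
move=> x /A1; rewrite /enorm2 => x1; split; rewrite /= in_itv /=; apply/andP; split.
- by nra.
- by nra.
- by nra.
- by nra.
Qed.

End euclidean_norm.

(** * Comparison along circles and lines *)

Definition supersolution {R : realType} (u : R * R -> \bar R) :=
  [/\ LSC punctured_disc u, Linfty_loc punctured_disc u &
      visc_supersol Gamma2 punctured_disc u].

Definition sq_profile {R : realType} (u : R * R -> \bar R) (x : R * R) : R :=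
  expR (- fine (u x) / 2).

Definition profile {R : realType} (u : R * R -> \bar R) (x : R * R) : R :=
  expR (- fine (u x) / 4).

Lemma profile_gt0 {R : realType} (u : R * R -> \bar R) x : 0 < profile u x.
Proof. exact: expR_gt0. Qed.

Lemma profile_sqr {R : realType} (u : R * R -> \bar R) x :
  profile u x ^+ 2 = sq_profile u x.
Proof. by rewrite /profile /sq_profile expr2 -expRD; congr expR; field. Qed.

Section supersolution.
Context {R : realType} (u : R * R -> \bar R) (su : supersolution u).
Implicit Types (x y : R * R) (k : polyexpr R).
Let lscu : LSC punctured_disc u. Proof. by case: su. Qed.
Let Lu : Linfty_loc punctured_disc u. Proof. by case: su. Qed.
Let usup : visc_supersol Gamma2 punctured_disc u. Proof. by case: su. Qed.
Local Notation h := (sq_profile u).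

Lemma supersol_fineK x : punctured_disc x -> (fine (u x))%:E = u x.
Proof.
move=> Ox; apply: fineK; rewrite fin_numE; apply/andP; split.
  by have [+ _ _] := lscu; apply.
by rewrite -ltey; exact: LSC_lt_pinfty open_punctured_disc lscu Lu Ox.
Qed.

Lemma supersol_ln x : punctured_disc x -> u x = (- 2 * ln (h x))%:E.
Proof. by move=> /supersol_fineK <-; rewrite /sq_profile expRK; congr _%:E; field. Qed.

Lemma sq_profile_gt0 x : 0 < h x. Proof. exact: expR_gt0. Qed.

Lemma sq_profile_lt x t : 0 < t -> punctured_disc x ->
  (h x < t) = ((- 2 * ln t)%:E < u x)%E.
Proof.
move=> t0 Ox; rewrite (supersol_ln x Ox) lte_fin -(ltr_ln (sq_profile_gt0 x) t0).
by apply/idP/idP; lra.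
Qed.

Lemma sq_profile_usc x t : punctured_disc x -> h x < t ->
  \forall y \near x, punctured_disc y -> h y < t.
Proof.
move=> Ox ht; have t0 : 0 < t by exact: lt_trans (sq_profile_gt0 x) ht.
have ut : ((- 2 * ln t)%:E < u x)%E by rewrite -sq_profile_lt.
by apply: filterS (LSC_near _ _ _ _ lscu Ox ut) => y uy Oy; rewrite sq_profile_lt // uy.
Qed.

(** The first three hypotheses are orthogonality of P and g for the Lorentzian
    form, and positivity of their discriminants.  The arc is
    {g = 0, k >= 0}; its ends are the points where k = 0.  The annulus
    r <= |x|^2 <= s only serves to have a compact neighbourhood of the arc
    inside the punctured disc. *)
Lemma conic_comparison (gam n1 n2 d a b1 b2 c r s : R) k :
  let g := quadric gam n1 n2 d in let P := quadric a b1 b2 c in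
  b1 * n1 + b2 * n2 - 2 * a * d - 2 * c * gam = 0 ->
  0 < n1 ^+ 2 + n2 ^+ 2 - 4 * d * gam ->
  0 < (b1 ^+ 2 + b2 ^+ 2) / 2 - 2 * a * c ->
  0 < r -> s < 1 ->
  (forall x, punctured_disc x -> peval g x = 0 -> 0 <= peval k x ->
    [/\ r < enorm2 x, enorm2 x < s, 0 < peval P x & (peval k x = 0 -> h x < peval P x)]) ->
  forall x, punctured_disc x -> peval g x = 0 -> 0 <= peval k x -> h x <= peval P x.
Proof.
move=> g P F0 E0 D0 r0 s1 hyp x Ox gx kx.
set E := n1 ^+ 2 + _ - _ in E0; set D := _ / 2 - _ in D0.
rewrite leNgt; apply/negP => Ph.
(* K is a compact neighbourhood of the arc; B is the part of K where a
   maximum of the quotient h / (P + N g^2) has to be excluded. *)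
pose K := [set y | r <= peval enorm2p y] `&`
  ([set y | peval enorm2p y <= s] `&` [set y | 0 <= peval k y]).
have KO y : K y -> punctured_disc y.
  move=> [ry [ys _]]; apply/punctured_discE; rewrite -peval_enorm2p.
  by rewrite (lt_le_trans r0 ry) (le_lt_trans ys s1).
have cK : compact K.
  apply: compact_subdisc => [|y [_ [ys _]]].
    by do ?apply: closedI; (exact: closed_peval_ge || exact: closed_peval_le).
  by rewrite -peval_enorm2p; exact: ltW (le_lt_trans ys s1).
have Kx : K x.
  by have [] := hyp x Ox gx kx; rewrite -peval_enorm2p => /ltW r1 /ltW r2 _ _; do 2?split.
have hK y t : K y -> h y < t -> \forall z \near y, K z -> h z < t.
  move=> Ky ht; apply: filterS (sq_profile_usc y t (KO _ Ky) ht) => z hz /KO; exact: hz.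
pose B := K `&` ([set y | peval enorm2p y <= r] `|`
  ([set y | s <= peval enorm2p y] `|` ([set y | peval k y <= 0] `|`
   ([set y | peval P y <= 0] `|`
    [set y | peval (Add (Cst E) (pscale (4 * d) g)) y <= E / 2])))).
have BK : B `<=` K by move=> y [].
have cB : compact B.
  apply: (@subclosed_compact _ B K) => //.
  apply: closedI; first exact: compact_closed (@norm_hausdorff _ _) cK.
  by do ?apply: closedU; (exact: closed_peval_ge || exact: closed_peval_le).
pose f y := h y - peval P y; pose G2 := Mul g g.
have usc_diff Q y t : K y -> h y - peval Q y < t ->
    \forall z \near y, K z -> h z - peval Q z < t.
  move=> Ky ft; pose e := (t - (h y - peval Q y)) / 2.
  have e0 : 0 < e by rewrite divr_gt0 // subr_gt0.
  have H1 : \forall z \near y, K z -> h z < h y + e.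
    by apply: hK => //; rewrite ltrDl.
  have H2 : \forall z \near y, peval Q y - e < peval Q z.
    by apply: near_peval_gt; rewrite gtrBl.
  near=> z => Kz.
  have : h z < h y + e by move: Kz; near: z.
  have : peval Q y - e < peval Q z by near: z.
  by rewrite /e; lra.
(* On B, a zero of g can only be an end of the arc, where h < P. *)
have [N1 hN1] : exists N, forall y, B y -> f y < N * peval G2 y.
  have [M hM] : exists M, forall y, K y -> f y <= M.
    have [m Km fm] := usc_argmax _ K f cK (ex_intro _ x Kx) (usc_diff P).
    by exists (f m).
  apply: (penalization _ B f (peval G2) M cB) => [y /BK/hM//|y _|y t [Ky _] ft|y t _|y [Ky By]].
  - exact: sqr_ge0.
  - by apply: filterS (usc_diff P y t Ky ft) => z fz [/fz].
  - by move=> /(near_peval_gt G2) H; apply: filterS H => z.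
  - move=> /eqP; rewrite /= -/(peval g y) mulf_eq0 orbb => /eqP gy.
    have ky : 0 <= peval k y by case: Ky => _ [].
    have [] := hyp y (KO _ Ky) gy ky; rewrite -peval_enorm2p => r1 r2 P0 kP.
    case: By => [yr|[ys|[yk|[yP|]]]].
    + by have := lt_le_trans r1 yr; rewrite ltxx.
    + by have := lt_le_trans r2 ys; rewrite ltxx.
    + by rewrite /f subr_lt0; apply: kP; apply/eqP; rewrite eq_le yk.
    + by have := lt_le_trans P0 yP; rewrite ltxx.
    + rewrite /mkset [peval _ _]/= -/(peval g y) gy; lra.
(* The second bound makes the factor c + N (E + 2 d g) nonnegative. *)
pose N := Num.max `|N1| (2 * `|c| / E).
have N1N : N1 <= N by rewrite le_max ler_norm.
have cN : 2 * `|c| / E <= N by rewrite le_max lexx orbT.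
have N0 : 0 <= N by rewrite le_max normr_ge0.
have {cN} cN : 2 * `|c| <= N * E by rewrite -ler_pdivrMr.
have hN y : B y -> h y < peval P y + N * peval G2 y.
  move=> By; rewrite -ltrBlDl; apply: lt_le_trans (hN1 y By) _.
  by rewrite ler_wpM2r //; exact: sqr_ge0.
pose H := Add P (pscale N G2).
have HE y : peval H y = peval P y + N * peval G2 y by [].
have G20 y : 0 <= peval G2 y by exact: sqr_ge0.
have H0 y : K y -> 0 < peval H y.
  move=> Ky; have [By|nBy] := pselect (B y).
    by rewrite HE; exact: lt_trans (sq_profile_gt0 y) (hN y By).
  have Py : 0 < peval P y.
    by rewrite ltNge; apply/negP => Py; apply: nBy; split=> //; do 3 right; left.
  by rewrite HE; exact: ltr_pwDl Py (mulr_ge0 N0 (G20 y)).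
(* A quotient is maximized, and not a difference, because the conditions
   on P are invariant under scaling but not under adding constants. *)
have [x1 Kx1 hx1] : exists2 y, K y & forall z, K z -> h z / peval H z <= h y / peval H y.
  apply: (usc_argmax _ K (fun y => h y / peval H y) cK); first by exists x.
  move=> y t Ky; rewrite ltr_pdivrMr ?H0 // => ht.
  have {ht}ht : h y - peval (pscale t H) y < 0 by rewrite subr_lt0.
  apply: filterS (usc_diff _ _ _ Ky ht) => z hz Kz.
  by rewrite ltr_pdivrMr ?H0 // -subr_lt0; exact: hz.
pose lam := h x1 / peval H x1.
have lam1 : 1 < lam.
  apply: (lt_le_trans _ (hx1 x Kx)); rewrite ltr_pdivlMr ?H0 // mul1r.
  by rewrite HE (_ : peval G2 x = peval g x * peval g x) // gx !mulr0 addr0.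
have lam0 : 0 < lam by exact: lt_trans ltr01 lam1.
have hxlam : h x1 = peval (pscale lam H) x1 by rewrite (_ : peval _ _ = lam * peval H x1) // divfK // gt_eqF ?H0.
have nBx1 : ~ B x1.
  by move=> /hN; rewrite -HE; move: lam1; rewrite ltr_pdivlMr ?H0 // mul1r; lra.
have [sr ss kx1 gE] : [/\ r < peval enorm2p x1, peval enorm2p x1 < s, 0 < peval k x1 &
    E / 2 < E + 4 * d * peval g x1].
  split; rewrite ltNge; apply/negP => bad; apply: nBx1; split => //.
  - by left.
  - by right; left.
  - by do 2 right; left.
  - by do 4 right.
have lamH : 0 < peval (pscale lam H) x1 by rewrite -hxlam sq_profile_gt0.
(* The direction tangent to the level curve of g through x1. *)
pose e := (- peval (pderiv 1 g) x1, peval (pderiv 0 g) x1).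
have := polynomial_test _ u (pscale lam H) x1 e usup (KO _ Kx1) lamH.
rewrite -{1}hxlam => /(_ (supersol_ln _ (KO _ Kx1))).
have near_le : \forall y \near x1, ((- 2 * ln (peval (pscale lam H) y))%:E <= u y)%E.
  have nr := near_peval_gt _ sr; have ns := near_peval_lt _ ss.
  have nk := near_peval_gt _ kx1; have nl := near_peval_gt _ lamH.
  near=> y.
  have Ky : K y by do 2?split; apply: ltW; near: y.
  rewrite (supersol_ln _ (KO _ Ky)) lee_fin ler_wnM2l //.
  have : 0 < peval (pscale lam H) y by near: y.
  move=> lH; rewrite ler_ln ?posrE ?sq_profile_gt0 //.
  by rewrite (_ : peval _ _ = lam * peval H y) // -ler_pdivrMr ?H0 // hx1.
move=> /(_ near_le).
set T := (X in 0 <= X -> _).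
(* Here E + 4 d g = |Dg|^2, and the term linear in g carries the
   Lorentzian product of P and g as a factor. *)
have -> : T = lam ^+ 2 * (E + 4 * d * peval g x1) *
   (- D - 2 * N * peval g x1 * (b1 * n1 + b2 * n2 - 2 * a * d - 2 * c * gam)
    - 2 * N * peval g x1 ^+ 2 * (c + N * (E + 2 * d * peval g x1))).
  rewrite /T /e /D /E /=.
  by field.
rewrite F0 mulr0 subr0.
have gE0 : 0 < E + 4 * d * peval g x1 by apply: lt_trans gE; rewrite divr_gt0.
rewrite leNgt => /negP; apply.
have k0 : 0 < lam ^+ 2 * (E + 4 * d * peval g x1).
  by apply: mulr_gt0 gE0; exact: exprn_gt0.
rewrite pmulr_rlt0 //.
have : 0 <= c + N * (E + 2 * d * peval g x1).
  have : N * (E / 2) <= N * (E + 2 * d * peval g x1) by rewrite ler_wpM2l //; lra.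
  by have := ler_norm (- c); rewrite normrN; lra.
move=> cNE; rewrite -oppr_gt0 opprB opprK ltr_wpDl //.
by apply: mulr_ge0 cNE; rewrite mulr_ge0 ?sqr_ge0 // mulr_ge0.
Unshelve. all: by end_near. Qed.
End supersolution.

(** * Convexity on chords missing the origin *)

Section chords.
Context {R : realType}.
Implicit Types (p q x y : R * R) (f : R * R -> R).

Definition chord p q (t : R) : R * R :=
  (p.1 + t * (q.1 - p.1), p.2 + t * (q.2 - p.2)).

Definition convex_off0 f := forall p q (t : R),
  punctured_disc p -> punctured_disc q ->
  (forall s, 0 <= s <= 1 -> chord p q s != 0) -> 0 <= t <= 1 ->
  f (chord p q t) <= (1 - t) * f p + t * f q.

(** On the line through p and q, [conic_comparison] is applied with
    P = (A + (B - A) s)^2 + eta s (1 - s), where A = w p + eta and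
    B = w q + eta.  The last summand makes the discriminant positive, and
    P converges to the square of the affine interpolation of w as eta
    tends to 0. *)
Lemma profile_convex_off0 (u : R * R -> \bar R) :
  supersolution u -> convex_off0 (profile u).
Proof.
move=> su p q t Op Oq seg0 /andP[t0 t1].
set w := profile u; pose h := sq_profile u.
have w0 x : 0 < w x by exact: profile_gt0.
have wh x : w x ^+ 2 = h x by exact: profile_sqr.
have [<-|pq] := eqVneq p q.
  rewrite (_ : chord p p t = p) ?le_eqVlt; first by apply/orP; left; apply/eqP; ring.
  by rewrite /chord !subrr !mulr0 !addr0; case: (p).
pose v1 := q.1 - p.1; pose v2 := q.2 - p.2; pose V := v1 ^+ 2 + v2 ^+ 2.
have V0 : 0 < V.
  rewrite /V lt0r addr_ge0 ?sqr_ge0 // andbT; apply: contra_neq pq => V0.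
  have /enorm2_eq0[] : enorm2 (v1, v2) = 0 by [].
  move=> /eqP; rewrite subr_eq0 => /eqP e1 /eqP; rewrite subr_eq0 => /eqP e2.
  by move: e1 e2; case: (p) (q) => ? ? [? ?] /= -> ->.
have V0' : V != 0 by rewrite gt_eqF.
pose g := quadric (v2 * p.1 - v1 * p.2) (- v2) v1 0.
pose L := quadric (- (v1 * p.1 + v2 * p.2)) v1 v2 0.
(* If s is the parameter of x along the chord, then L = V s and
   k = V^2 s (1 - s). *)
pose k := Mul L (Add (Cst V) (pscale (- 1) L)).
have xE x : peval g x = 0 -> x = chord p q (peval L x / V).
  move=> gx; rewrite [LHS]surjective_pairing; congr pair.
    rewrite -[LHS]subr0 -[X in _ - X](mulr0 (- v2 / V)) -gx /= -/v1 /V.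
    by field.
  rewrite -[LHS]subr0 -[X in _ - X](mulr0 (v1 / V)) -gx /= -/v2 /V.
  by field.
have kf x : peval k x = peval L x * (V + - 1 * peval L x) by [].
have kE x : 0 <= peval k x -> 0 <= peval L x / V <= 1.
  rewrite kf => kx.
  rewrite ler_pdivlMr // ler_pdivrMr // mul0r mul1r.
  by apply/andP; split; nra.
pose Z := [set x | 0 <= peval g x] `&` ([set x | peval g x <= 0] `&` [set x | 0 <= peval k x]).
have ZE x : Z x -> exists2 s, 0 <= s <= 1 & x = chord p q s.
  move=> [g0 [g1 k0]]; exists (peval L x / V); first exact: kE.
  by apply: xE; apply/eqP; rewrite eq_le g0 g1.
pose m := Num.max (enorm2 p) (enorm2 q).
have m1 : m < 1.
  by rewrite gt_max; move/punctured_discE : Op => /andP[_ ->];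
    move/punctured_discE : Oq => /andP[_ ->].
have segm s : 0 <= s <= 1 -> enorm2 (chord p q s) <= m.
  move=> /andP[s0 s1].
  have pm : enorm2 p <= m by rewrite le_max lexx.
  have qm : enorm2 q <= m by rewrite le_max lexx orbT.
  have : enorm2 (chord p q s) = (1 - s) * enorm2 p + s * enorm2 q - s * (1 - s) * V.
    by rewrite /enorm2 /V /v1 /v2 /=; ring.
  have : 0 <= s * (1 - s) * V by rewrite !mulr_ge0 ?subr_ge0 // ltW.
  have : (1 - s) * enorm2 p <= (1 - s) * m by rewrite ler_wpM2l ?subr_ge0.
  have : s * enorm2 q <= s * m by rewrite ler_wpM2l.
  by lra.
have cZ : compact Z.
  apply: compact_subdisc.
    by do ?apply: closedI; (exact: closed_peval_ge || exact: closed_peval_le).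
  by move=> x /ZE[s s01 ->]; exact: le_trans (segm s s01) (ltW m1).
have gp : peval g p = 0 by rewrite /=; ring.
have Lp : peval L p = 0 by rewrite /=; ring.
have Zp : Z p.
  split; [|split]; rewrite /mkset ?gp //.
  by rewrite kf Lp mul0r.
(* z is the point of the chord closest to the origin. *)
have [z Zz hz] : exists2 z, Z z & forall x, Z x -> peval enorm2p z <= peval enorm2p x.
  have [|z Zz hz] := usc_argmax _ Z (fun x => - peval enorm2p x) cZ (ex_intro _ p Zp).
    move=> x s _; rewrite ltrNl => /(near_peval_gt enorm2p); apply: filterS => y.
    by rewrite ltrNl => + _.
  by exists z => // x /hz; rewrite lerN2.
have z0 : 0 < enorm2 z by have [s s01 ->] := ZE z Zz; exact: enorm2_gt0 (seg0 s s01).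
have key eta : 0 < eta ->
    h (chord p q t) <= ((1 - t) * w p + t * w q + eta) ^+ 2 + eta * (t * (1 - t)).
  move=> eta0; pose A := w p + eta; pose B := w q + eta; pose D := B - A.
  have A0 : 0 < A by rewrite addr_gt0.
  have B0 : 0 < B by rewrite addr_gt0.
  pose be := (2 * A * D + eta) / V; pose c := (D ^+ 2 - eta) / V.
  pose a := A ^+ 2 - be * (v1 * p.1 + v2 * p.2) + c * enorm2 p.
  pose b1 := be * v1 - 2 * c * p.1; pose b2 := be * v2 - 2 * c * p.2.
  have PE s : peval (quadric a b1 b2 c) (chord p q s) =
     ((1 - s) * w p + s * w q + eta) ^+ 2 + eta * (s * (1 - s)).
    rewrite /= /a /b1 /b2 /be /c /D /A /B /V -/v1 -/v2 /enorm2.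
    by field.
  rewrite -PE.
  apply: (conic_comparison u su (v2 * p.1 - v1 * p.2) (- v2) v1 0 a b1 b2 c
    (enorm2 z / 2) ((1 + m) / 2) k).
  - by rewrite /b1 /b2; ring.
  - by move: V0; rewrite /V; nra.
  - rewrite (_ : _ - _ = eta * (2 * A * B + eta / 2) / V).
      rewrite divr_gt0 // mulr_gt0 // addr_gt0 ?divr_gt0 // !mulr_gt0 //.
    rewrite /a /b1 /b2 /be /c /D /V /enorm2; field.
    exact: V0'.
  - by rewrite divr_gt0.
  - by lra.
  - move=> x Ox gx kx.
    have Zx : Z x by split; [|split]; rewrite /mkset ?gx.
    have := hz x Zx; rewrite !peval_enorm2p => zx.
    have s01 := kE x kx; have xs := xE x gx.
    split.
    + lra.
    + by rewrite xs; have := segm _ s01; lra.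
    + rewrite xs PE; move: (peval L x / V) s01 => sg /andP[s0 s1].
      apply: ltr_pwDl; last by rewrite !mulr_ge0 ?subr_ge0 ?(ltW eta0).
      apply: exprn_gt0; apply: ltr_wpDl => //.
      by apply: addr_ge0; rewrite mulr_ge0 ?subr_ge0 // ltW.
    + move=> k0; rewrite {2}xs PE.
      have : peval L x / V = 0 \/ peval L x / V = 1.
        move/eqP : k0; rewrite kf mulf_eq0 => /orP[/eqP l0|/eqP l1].
          by left; rewrite l0 mul0r.
        right; apply: (mulIf V0'); rewrite divfK // mul1r.
        by move: l1; lra.
      move=> [] e01; rewrite e01 in xs *.
        have -> : x = p by rewrite xs /chord !mul0r !addr0; case: (p).
        rewrite -[sq_profile u p]wh; have := w0 p; nra.
      have -> : x = q by rewrite xs /chord !mul1r !subrKC; case: (q).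
      rewrite -[sq_profile u q]wh; have := w0 q; nra.
  - apply/punctured_discE; rewrite (le_lt_trans _ m1) ?segm ?t0 // andbT.
    by apply: enorm2_gt0; apply: seg0; rewrite t0.
  - by rewrite /= -/v1 -/v2; ring.
  - rewrite (_ : peval k _ = t * V * (V * (1 - t))).
      by rewrite !mulr_ge0 ?subr_ge0 // ltW.
    by rewrite /= -/v1 -/v2 /V; ring.
rewrite leNgt; apply/negP => lt_w.
set l := _ * w p + _ in key lt_w.
have l0 : 0 <= l by rewrite addr_ge0 // mulr_ge0 ?subr_ge0 // ltW.
pose De := w (chord p q t) - l.
have De0 : 0 < De by rewrite subr_gt0.
(* With l the affine interpolation and De the excess of w over it, this eta
   gives (l + eta)^2 + eta < (l + De)^2. *)
pose eta := Num.min (De / 2) (De ^+ 2 / 2).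
have eta0 : 0 < eta by rewrite lt_min !divr_gt0 // exprn_gt0.
have := key eta eta0; rewrite -wh.
have : eta <= De / 2 by rewrite ge_min lexx.
have : eta <= De ^+ 2 / 2 by rewrite ge_min lexx orbT.
have -> : w (chord p q t) = l + De by rewrite /De; ring.
have tt : t * (1 - t) <= 1 by nra.
have : eta * (t * (1 - t)) <= eta by rewrite ler_piMr // ltW.
move: (eta) eta0 => e e0; nra.
Qed.

End chords.

(** * Bounds for functions that are convex off the origin *)

Section lipschitz.
Context {R : realType}.
Implicit Types (p q x y : R * R) (f : R * R -> R).

Lemma enorm_le x (r : R) : 0 <= r -> (enorm x <= r) = (enorm2 x <= r ^+ 2).
Proof. by move=> r0; rewrite -enorm_sqr ler_sqr ?nnegrE ?enorm_ge0. Qed.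

Lemma enormD x y : enorm (x + y) <= enorm x + enorm y.
Proof.
rewrite enorm_le ?addr_ge0 ?enorm_ge0 // sqrrD !enorm_sqr.
have cs : x.1 * y.1 + x.2 * y.2 <= enorm x * enorm y.
  apply: le_trans (ler_norm _) _.
  rewrite -ler_sqr ?nnegrE ?mulr_ge0 ?enorm_ge0 // exprMn !enorm_sqr.
  rewrite real_normK ?num_real // -subr_ge0.
  rewrite (_ : _ - _ = (x.1 * y.2 - x.2 * y.1) ^+ 2) ?sqr_ge0 //.
  by rewrite /enorm2; ring.
by move: cs; rewrite /enorm2 /=; lra.
Qed.

Lemma enormN x : enorm (- x) = enorm x.
Proof. by rewrite /enorm /= !sqrrN. Qed.

Lemma enormB x y : enorm (x - y) = enorm (y - x).
Proof. by rewrite -enormN opprB. Qed.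

Lemma enorm0 : enorm (0 : R * R) = 0.
Proof. by rewrite /enorm expr0n addr0 sqrtr0. Qed.

Lemma cross_chord0 x y s : chord x y s = 0 -> x.1 * y.2 - x.2 * y.1 = 0.
Proof.
move=> [e1 e2].
have h1 : (1 - s) * (x.1 * y.2 - x.2 * y.1) = 0.
  transitivity ((x.1 + s * (y.1 - x.1)) * y.2 - (x.2 + s * (y.2 - x.2)) * y.1).
    by ring.
  by rewrite e1 e2 !mul0r subrr.
have h2 : s * (x.1 * y.2 - x.2 * y.1) = 0.
  transitivity (x.1 * (x.2 + s * (y.2 - x.2)) - x.2 * (x.1 + s * (y.1 - x.1))).
    by ring.
  by rewrite e1 e2 !mulr0 subrr.
by move: h1; rewrite mulrBl h2 mul1r subr0.
Qed.

(** The chord through x orthogonal to x misses the origin and has x as its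
    midpoint. *)
Lemma convex_le_sphere f (r M : R) x : convex_off0 f -> 0 < r -> r < 1 ->
  (forall z, enorm2 z = r ^+ 2 -> f z <= M) ->
  0 < enorm2 x -> enorm2 x <= r ^+ 2 -> f x <= M.
Proof.
move=> cf r0 r1 fM x0 xr.
pose tau := Num.sqrt (r ^+ 2 / enorm2 x - 1).
have tau2 : tau ^+ 2 = r ^+ 2 / enorm2 x - 1.
  by rewrite sqr_sqrtr // subr_ge0 ler_pdivlMr // mul1r.
pose pt s : R * R := (x.1 - s * x.2, x.2 + s * x.1).
have ptE s : enorm2 (pt s) = (1 + s ^+ 2) * enorm2 x by rewrite /enorm2 /=; ring.
have p1 : enorm2 (pt tau) = r ^+ 2 by rewrite ptE tau2 subrKC divfK ?gt_eqF.
have p2 : enorm2 (pt (- tau)) = r ^+ 2 by rewrite ptE sqrrN tau2 subrKC divfK ?gt_eqF.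
have r2 : 0 < r ^+ 2 < 1 by rewrite exprn_gt0 // exprn_ilt1 // ltW.
have := cf (pt (- tau)) (pt tau) 2^-1.
have segE s : chord (pt (- tau)) (pt tau) s = pt (tau * (2 * s - 1)).
  by rewrite /chord /pt /=; congr pair; ring.
have -> : chord (pt (- tau)) (pt tau) 2^-1 = x.
  rewrite segE mulfV // subrr mulr0 /pt !mul0r subr0 addr0; by case: (x).
have H1 : punctured_disc (pt (- tau)) by apply/punctured_discE; rewrite p2.
have H2 : punctured_disc (pt tau) by apply/punctured_discE; rewrite p1.
have H3 s : 0 <= s <= 1 -> chord (pt (- tau)) (pt tau) s != 0.
  move=> _; rewrite segE; apply/eqP => /(congr1 enorm2); rewrite ptE.
  rewrite [RHS](_ : _ = 0); last by rewrite /enorm2 expr0n addr0.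
  move/eqP; rewrite mulf_eq0 (gt_eqF x0) orbF; apply/negP.
  by rewrite gt_eqF // ltr_pwDl // sqr_ge0.
move=> /(_ H1 H2 H3) H; have := fM _ p1; have := fM _ p2.
have half : 0 <= (2^-1 : R) <= 1 by lra.
by have := H half; lra.
Qed.

(** Extend the segment from x to y up to the point z of the circle of radius r'.
    By convexity the slope from x to y is at most the slope from x to z, and
    |z - x| >= r' - r. *)
Lemma lipschitz_off_line f (r r' M : R) x y : convex_off0 f ->
  (forall z, 0 <= f z) -> 0 < r -> r < r' -> r' < 1 ->
  (forall z, enorm2 z = r' ^+ 2 -> f z <= M) ->
  enorm x <= r -> enorm y <= r -> x.1 * y.2 - x.2 * y.1 != 0 ->
  f y - f x <= M / (r' - r) * enorm (y - x).
Proof.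
move=> cf f0 r0 rr r1 fM xr yr cross.
have r'0 : 0 < r' by exact: lt_trans rr.
pose v1 := y.1 - x.1; pose v2 := y.2 - x.2; pose V := v1 ^+ 2 + v2 ^+ 2.
pose xv := x.1 * v1 + x.2 * v2.
have V0 : 0 < V.
  rewrite /V lt0r addr_ge0 ?sqr_ge0 // andbT; apply: contra_neq cross => V0.
  have /enorm2_eq0[] : enorm2 (v1, v2) = 0 by [].
  rewrite /v1 /v2 => e1 e2.
  transitivity (x.1 * (y.2 - x.2) - x.2 * (y.1 - x.1)); first by ring.
  by rewrite e1 e2 !mulr0 subrr.
have V0' : V != 0 by rewrite gt_eqF.
have xr2 : enorm2 x <= r ^+ 2 by rewrite -enorm_le // ltW.
have yr2 : enorm2 y <= r ^+ 2 by rewrite -enorm_le // ltW.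
have rr2 : r ^+ 2 < r' ^+ 2 by rewrite ltr_sqr ?nnegrE ?(ltW r0) ?(ltW r'0).
pose De := xv ^+ 2 + V * (r' ^+ 2 - enorm2 x).
have De0 : 0 <= De by rewrite addr_ge0 ?sqr_ge0 // mulr_ge0 ?(ltW V0) //; lra.
(* t is the larger root of |x + t (y - x)|^2 = r'^2. *)
pose t := (Num.sqrt De - xv) / V.
have t1 : 1 <= t.
  rewrite ler_pdivlMr // mul1r lerBrDr.
  apply: le_trans (ler_norm _) _; rewrite -sqrtr_sqr ler_sqrt // /De.
  have yE : enorm2 y = enorm2 x + 2 * xv + V by rewrite /enorm2 /xv /V /v1 /v2; ring.
  have : V * enorm2 y <= V * r' ^+ 2 by rewrite ler_pM2l //; lra.
  by rewrite yE; nra.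
have t0 : 0 < t by exact: lt_le_trans t1.
have szt : enorm2 (chord x y t) = r' ^+ 2.
  have -> : enorm2 (chord x y t) = enorm2 x + 2 * t * xv + t ^+ 2 * V.
    by rewrite /enorm2 /xv /V /v1 /v2 /=; ring.
  have s2 : Num.sqrt De ^+ 2 = De by rewrite sqr_sqrtr.
  transitivity (enorm2 x + (Num.sqrt De ^+ 2 - xv ^+ 2) / V).
    by rewrite /t; field.
  by rewrite s2 /De; field.
set z := chord x y t in szt.
have Oz : punctured_disc z.
  by apply/punctured_discE; rewrite szt exprn_gt0 // exprn_ilt1 // ltW.
have x0 : x != 0 by apply: contra_neq cross => ->; rewrite !mul0r subrr.
have Ox : punctured_disc x.
  apply/punctured_discE; rewrite enorm2_gt0 //=.
  by apply: le_lt_trans xr2 (lt_trans rr2 _); rewrite exprn_ilt1 // ltW.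
have segE s : chord x z s = chord x y (s * t).
  by rewrite /chord /z /chord /=; congr pair; ring.
have seg0 s : 0 <= s <= 1 -> chord x z s != 0.
  by move=> _; rewrite segE; apply: contra_neq cross => /cross_chord0.
have it : 0 <= t^-1 <= 1 by rewrite invr_ge0 (ltW t0) /= invf_le1.
have := cf x z t^-1 Ox Oz seg0 it.
rewrite segE mulVf ?gt_eqF // (_ : chord x y 1 = y); last first.
  by rewrite /chord !mul1r !subrKC; case: (y).
have zM := fM z szt; have fx := f0 x.
have M0 : 0 <= M by exact: le_trans (f0 z) zM.
have tz : r' - r <= t * enorm (y - x).
  have -> : t * enorm (y - x) = enorm (z - x).
    rewrite -[t]gtr0_norm // -sqrtr_sqr -sqrtrM ?sqr_ge0 //.
    by congr Num.sqrt; rewrite /= ; ring.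
  have ez : enorm z = r' by rewrite /enorm -/(enorm2 z) szt sqrtr_sqr gtr0_norm.
  by have := enormD (z - x) x; rewrite subrK ez; lra.
move=> H.
have : M * t^-1 <= M / (r' - r) * enorm (y - x).
  rewrite -mulrA ler_wpM2l // mulrC ler_pdivlMr ?subr_gt0 // mulrC.
  by rewrite ler_pdivrMr // mulrC.
have : t^-1 * f z <= t^-1 * M by rewrite ler_wpM2l //; case/andP: it.
have : 0 <= t^-1 * f x by rewrite mulr_ge0 //; case/andP: it.
lra.
Qed.

(** When x and y are aligned with the origin, the estimate passes through a
    nearby point y' which is aligned with neither of them. *)
Lemma lipschitz_punctured f (r r' M : R) x y : convex_off0 f ->
  (forall z, 0 <= f z) -> 0 < r -> r < r' -> r' < 1 ->
  (forall z, enorm2 z = r' ^+ 2 -> f z <= M) ->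
  enorm x <= r -> enorm y <= r -> x != 0 -> y != 0 ->
  f y - f x <= M / (r' - r) * enorm (y - x).
Proof.
move=> cf f0 r0 rr r1 fM xr yr x0 y0.
have off := lipschitz_off_line f r r' M _ _ cf f0 r0 rr r1 fM.
have [c0|] := eqVneq (x.1 * y.2 - x.2 * y.1) 0; last exact: off.
set La := M / (r' - r).
have La0 : 0 <= La.
  rewrite divr_ge0 ?subr_ge0 ?(ltW rr) //.
  apply: le_trans (f0 (r', 0)) (fM _ _); by rewrite /enorm2 expr0n addr0.
have sx := enorm2_gt0 x x0; have sy := enorm2_gt0 y y0.
have dot : x.1 * y.1 + x.2 * y.2 != 0.
  apply/eqP => d0; have : enorm2 x * enorm2 y = 0.
    transitivity ((x.1 * y.2 - x.2 * y.1) ^+ 2 + (x.1 * y.1 + x.2 * y.2) ^+ 2).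
      by rewrite /enorm2; ring.
    by rewrite c0 d0 expr0n addr0.
  by apply/eqP; rewrite mulf_neq0 // gt_eqF.
have rlt1 : r < 1 by exact: lt_trans r1.
have key tau : 0 < tau -> tau < 1 -> f y - f x <= La * (enorm (y - x) + 4 * tau).
  move=> t0 t1.
  (* The convex combination of y and of its rotation by a right angle stays in
     the ball of radius r. *)
  pose y' : R * R := ((1 - tau) * y.1 - tau * y.2, (1 - tau) * y.2 + tau * y.1).
  have y'r : enorm y' <= r.
    rewrite (le_trans _ yr) // enorm_le ?enorm_ge0 // enorm_sqr.
    have -> : enorm2 y' = ((1 - tau) ^+ 2 + tau ^+ 2) * enorm2 y by rewrite /enorm2 /=; ring.
    by rewrite ler_piMl ?ltW //; nra.
  have d1 : f y - f y' <= La * enorm (y - y').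
    apply: off => //; rewrite (_ : _ - _ = - tau * enorm2 y).
      by apply: mulf_neq0; rewrite ?oppr_eq0 gt_eqF.
    by rewrite /enorm2 /=; ring.
  have d2 : f y' - f x <= La * enorm (y' - x).
    apply: off => //; rewrite (_ : _ - _ = tau * (x.1 * y.1 + x.2 * y.2)).
      by apply: mulf_neq0 => //; rewrite gt_eqF.
    transitivity ((1 - tau) * (x.1 * y.2 - x.2 * y.1) +
      tau * (x.1 * y.1 + x.2 * y.2)); first by rewrite /=; ring.
    by rewrite c0 mulr0 add0r.
  have e1 : enorm (y - y') <= 2 * tau.
    rewrite enorm_le ?mulr_ge0 ?ltW //.
    have -> : enorm2 (y - y') = 2 * tau ^+ 2 * enorm2 y by rewrite /enorm2 /=; ring.
    have y1 : enorm2 y <= 1.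
      by rewrite -enorm_sqr expr_le1 ?enorm_ge0 // (le_trans yr) // ltW.
    have : 0 <= tau ^+ 2 by exact: sqr_ge0.
    by nra.
  have e2 : enorm (y' - x) <= enorm (y - y') + enorm (y - x).
    by rewrite [enorm (y - y')]enormB; have := enormD (y' - y) (y - x); rewrite addrA subrK.
  have : La * enorm (y - y') <= La * (2 * tau) by rewrite ler_wpM2l.
  have : La * enorm (y' - x) <= La * (2 * tau + enorm (y - x)).
    by rewrite ler_wpM2l //; lra.
  by lra.
apply/ler_addgt0Pr => e e0.
pose tau := Num.min 2^-1 (e / (4 * La + 1)).
have La1 : 0 < 4 * La + 1 by rewrite ltr_wpDl // mulr_ge0.
have t0 : 0 < tau by rewrite lt_min invr_gt0 ltr0n divr_gt0.
have t2 : tau <= 2^-1 by rewrite ge_min lexx.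
have te : tau * (4 * La + 1) <= e by rewrite -ler_pdivlMr // ge_min lexx orbT.
by have := key tau t0 (_ : tau < 1); nra.
Qed.

End lipschitz.

(** * Circles through the origin *)

Section circles.
Context {R : realType} (u : R * R -> \bar R) (su : supersolution u).
Context (L : R) (L0 : 0 < L).
Local Notation h := (sq_profile u).
Context (hL : forall x, punctured_disc x -> enorm2 x <= 4^-1 -> h x <= L * enorm2 x).
Implicit Types (a x z : R * R).

(** The circle with diameter from 0 to a is {|x|^2 = a . x}.  The inversion
    y = x / |x|^2 maps it to the line {a . y = 1}, on which [sig] is an affine
    coordinate; sg chooses its orientation.  On this line h / |x|^2 is at most
    L far away, hence at most c0 + L (sig - sig z0) / (S - sig z0) between z0
    and the point where sig = S; the slope tends to 0 as S grows. *)
Lemma circle_le_oriented (sg : R) a z0 z1 : sg ^+ 2 = 1 ->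
  let sig x := sg * (a.1 * x.2 - a.2 * x.1) / enorm2 x in
  punctured_disc a -> punctured_disc z0 -> punctured_disc z1 ->
  enorm2 z0 = a.1 * z0.1 + a.2 * z0.2 -> enorm2 z1 = a.1 * z1.1 + a.2 * z1.2 ->
  sig z0 <= sig z1 -> h z1 / enorm2 z1 <= h z0 / enorm2 z0.
Proof.
move=> sg2 sig Oa Oz0 Oz1 cz0 cz1 s01.
have pos x : punctured_disc x -> 0 < enorm2 x by move=> /punctured_discE /andP[].
have a0 := pos _ Oa; have z00 := pos _ Oz0; have z10 := pos _ Oz1.
have a1 : enorm2 a < 1 by move/punctured_discE : Oa => /andP[].
pose e1 := - sg * a.2; pose e2 := sg * a.1.
have sigE x : 0 < enorm2 x -> e1 * x.1 + e2 * x.2 = sig x * enorm2 x.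
  by move=> x0; rewrite /sig divfK ?gt_eqF // /e1 /e2; ring.
have ee : e1 ^+ 2 + e2 ^+ 2 = enorm2 a.
  transitivity (sg ^+ 2 * enorm2 a); first by rewrite /e1 /e2 /enorm2; ring.
  by rewrite sg2 mul1r.
have circE x : 0 < enorm2 x -> enorm2 x = a.1 * x.1 + a.2 * x.2 ->
    enorm2 x * (1 + sig x ^+ 2) = enorm2 a.
  move=> x0 cx; apply: (mulfI (lt0r_neq0 x0)).
  transitivity ((a.1 * x.1 + a.2 * x.2) ^+ 2 + (e1 * x.1 + e2 * x.2) ^+ 2).
    by rewrite (sigE x x0) -cx; ring.
  transitivity ((a.1 * x.1 + a.2 * x.2) ^+ 2 + sg ^+ 2 * (a.1 * x.2 - a.2 * x.1) ^+ 2).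
    by rewrite /e1 /e2; ring.
  by rewrite sg2 /enorm2; ring.
have ptE x : 0 < enorm2 x -> enorm2 x = a.1 * x.1 + a.2 * x.2 ->
    x = ((a.1 + sig x * e1) / (1 + sig x ^+ 2), (a.2 + sig x * e2) / (1 + sig x ^+ 2)).
  move=> x0 cx.
  have q0 : 1 + sig x ^+ 2 != 0 by rewrite gt_eqF // ltr_pwDl // sqr_ge0.
  have sa : enorm2 x * (a.1 + sig x * e1) = enorm2 a * x.1.
    transitivity ((a.1 * x.1 + a.2 * x.2) * a.1 + (e1 * x.1 + e2 * x.2) * e1).
      by rewrite (sigE x x0) -cx; ring.
    transitivity ((a.1 * x.1 + a.2 * x.2) * a.1 - sg ^+ 2 * (a.1 * x.2 - a.2 * x.1) * a.2).
      by rewrite /e1 /e2; ring.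
    by rewrite sg2 /enorm2; ring.
  have sb : enorm2 x * (a.2 + sig x * e2) = enorm2 a * x.2.
    transitivity ((a.1 * x.1 + a.2 * x.2) * a.2 + (e1 * x.1 + e2 * x.2) * e2).
      by rewrite (sigE x x0) -cx; ring.
    transitivity ((a.1 * x.1 + a.2 * x.2) * a.2 + sg ^+ 2 * (a.1 * x.2 - a.2 * x.1) * a.1).
      by rewrite /e1 /e2; ring.
    by rewrite sg2 /enorm2; ring.
  rewrite [LHS]surjective_pairing; congr pair; apply: (mulIf q0); rewrite divfK //;
    apply: (mulfI (lt0r_neq0 x0)).
    by rewrite sa -(circE x x0 cx); ring.
  by rewrite sb -(circE x x0 cx); ring.
apply/ler_addgt0Pr => e e0; pose eta := e / 2.
have eta0 : 0 < eta by rewrite divr_gt0.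
pose c0 := h z0 / enorm2 z0 + eta.
have c00 : 0 < c0 by rewrite addr_gt0 // divr_gt0 // expR_gt0.
(* S >= 2 and |a| < 1 put the point with sig = S in the disc of radius 1/2,
   where the bound hL applies; the last summand makes the slope small. *)
pose S := `|sig z0| + `|sig z1| + 2 + L * (sig z1 - sig z0) / eta.
have Lse : 0 <= L * (sig z1 - sig z0) / eta.
  by rewrite !mulr_ge0 ?subr_ge0 ?invr_ge0 // ltW.
have := ler_norm (sig z0); have := ler_norm (sig z1).
have := normr_ge0 (sig z0); have := normr_ge0 (sig z1) => n1 n0 l1 l0.
have S2 : 2 <= S by rewrite /S; lra.
have S0 : sig z0 < S by rewrite /S; lra.
have S1 : sig z1 < S by rewrite /S; lra.
pose be := L / (S - sig z0).
have be0 : 0 < be by rewrite divr_gt0 // subr_gt0.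
pose c := c0 - be * sig z0.
pose k := Mul (quadric 0 e1 e2 (- sig z0)) (quadric 0 (- e1) (- e2) S).
have kE x : 0 < enorm2 x -> peval k x = enorm2 x ^+ 2 * ((sig x - sig z0) * (S - sig x)).
  move=> x0; transitivity ((e1 * x.1 + e2 * x.2 - sig z0 * enorm2 x) *
      (S * enorm2 x - (e1 * x.1 + e2 * x.2))); first by rewrite /= /enorm2; ring.
  by rewrite (sigE x x0); ring.
have PE x : 0 < enorm2 x ->
    peval (quadric 0 (be * e1) (be * e2) c) x = enorm2 x * (c0 + be * (sig x - sig z0)).
  move=> x0; transitivity (be * (e1 * x.1 + e2 * x.2) + c * enorm2 x).
    by rewrite /= /enorm2; ring.
  by rewrite (sigE x x0) /c; ring.
have gE x : peval (quadric 0 a.1 a.2 (- 1)) x = 0 -> enorm2 x = a.1 * x.1 + a.2 * x.2.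
  move=> gx; rewrite -[LHS]addr0 -gx /= /enorm2; ring.
(* Both P and g vanish at the origin; they are orthogonal because the linear
   part of P is orthogonal to a. *)
have h1 : h z1 <= peval (quadric 0 (be * e1) (be * e2) c) z1.
  apply: (conic_comparison u su 0 a.1 a.2 (- 1) 0 (be * e1) (be * e2) c
    (enorm2 a / (2 + sig z0 ^+ 2 + S ^+ 2)) ((1 + enorm2 a) / 2) k) => //.
  - by rewrite /e1 /e2; ring.
  - by rewrite mulr0 subr0.
  - rewrite mulr0 mul0r subr0 divr_gt0 //.
    have be2 : 0 < be ^+ 2 * enorm2 a by exact: mulr_gt0 (exprn_gt0 2 be0) a0.
    by rewrite (_ : _ + _ = be ^+ 2 * enorm2 a) // -ee; ring.
  - by rewrite divr_gt0 // ltr_pwDl ?sqr_ge0 // ltr_pwDl ?sqr_ge0.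
  - by lra.
  - move=> x Ox /gE cx; have x0 := pos _ Ox.
    rewrite kE // pmulr_rge0 ?exprn_gt0 // => kx.
    have sx0 : sig z0 <= sig x by nra.
    have sxS : sig x <= S by nra.
    have cc := circE x x0 cx.
    have xa : enorm2 x <= enorm2 a by rewrite -cc ler_peMr ?(ltW x0) // lerDl sqr_ge0.
    split.
    + rewrite ltr_pdivrMr; last by rewrite ltr_pwDl ?sqr_ge0 // ltr_pwDl ?sqr_ge0.
      rewrite -cc ltr_pM2l //.
      have := sqr_ge0 (sig z0); have := sqr_ge0 S.
      have [s0|s0] := lerP 0 (sig x).
        have : sig x ^+ 2 <= S ^+ 2 by nra.
        by lra.
      have : sig x ^+ 2 <= sig z0 ^+ 2 by nra.
      by lra.
    + by lra.
    + rewrite PE // mulr_gt0 // ltr_pwDl // mulr_ge0 ?subr_ge0 //.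
      exact: ltW.
    + move=> kx0; rewrite PE //.
      have [sx|sx] : sig x = sig z0 \/ S = sig x.
        have x20 : enorm2 x ^+ 2 != 0 by rewrite gt_eqF // exprn_gt0.
        move/eqP : kx0; rewrite mulf_eq0 (negbTE x20) /= mulf_eq0 !subr_eq0.
        by case/orP => /eqP; [left|right].
        have -> : x = z0 by rewrite (ptE x x0 cx) (ptE z0 z00 cz0) sx.
        rewrite subrr mulr0 addr0 /c0 mulrDr mulrC divfK ?gt_eqF //.
        by rewrite ltrDl mulr_gt0.
      rewrite -sx /be divfK ?gt_eqF ?subr_gt0 //.
      apply: le_lt_trans (hL x Ox _) _.
        have : enorm2 x * 4 <= enorm2 x * (1 + sig x ^+ 2).
          by rewrite ler_pM2l // -sx; nra.
        by rewrite cc; lra.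
      by rewrite [L * _]mulrC ltr_pM2l // ltrDr.
  - by move: cz1; rewrite /= /enorm2; lra.
  - rewrite kE //; apply: mulr_ge0; first exact: sqr_ge0.
    by apply: mulr_ge0; rewrite subr_ge0 // ltW.
rewrite ler_pdivrMr //; apply: (le_trans h1); rewrite PE // mulrC ler_pM2r //.
rewrite /c0 -addrA lerD2l.
suff : be * (sig z1 - sig z0) <= eta by rewrite /eta; lra.
rewrite /be mulrAC ler_pdivrMr ?subr_gt0 // [eta * _]mulrC -ler_pdivrMr //.
by rewrite /S; lra.
Qed.

Lemma circle_const a z : punctured_disc a -> punctured_disc z ->
  enorm2 z = a.1 * z.1 + a.2 * z.2 -> h z / enorm2 z = h a / enorm2 a.
Proof.
move=> Oa Oz cz.
have ca : enorm2 a = a.1 * a.1 + a.2 * a.2 by rewrite /enorm2 !expr2.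
have m1 : (-1 : R) ^+ 2 = 1 by rewrite sqrrN expr1n.
have p1 : (1 : R) ^+ 2 = 1 by rewrite expr1n.
apply/eqP; rewrite eq_le; apply/andP; split.
  have [s|s] := leP (1 * (a.1 * a.2 - a.2 * a.1) / enorm2 a)
                    (1 * (a.1 * z.2 - a.2 * z.1) / enorm2 z).
    exact: (circle_le_oriented 1 a a z).
  apply: (circle_le_oriented (-1) a a z) => //.
  by rewrite !mulN1r !mulNr lerN2 -[X in X / _ <= _]mul1r -[X in _ <= X / _]mul1r ltW.
have [s|s] := leP (1 * (a.1 * z.2 - a.2 * z.1) / enorm2 z)
                  (1 * (a.1 * a.2 - a.2 * a.1) / enorm2 a).
  exact: (circle_le_oriented 1 a z a).
apply: (circle_le_oriented (-1) a z a) => //.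
by rewrite !mulN1r !mulNr lerN2 -[X in X / _ <= _]mul1r -[X in _ <= X / _]mul1r ltW.
Qed.

(** The circles of a and b meet again at the foot z of the perpendicular from
    the origin to the line through a and b. *)
Lemma independent_const a b : punctured_disc a -> punctured_disc b ->
  a.1 * b.2 - a.2 * b.1 != 0 -> h a / enorm2 a = h b / enorm2 b.
Proof.
move=> Oa Ob cr.
pose v1 := b.1 - a.1; pose v2 := b.2 - a.2.
pose V := v1 ^+ 2 + v2 ^+ 2; pose C := a.1 * b.2 - a.2 * b.1.
have V0 : 0 < V.
  rewrite /V lt0r addr_ge0 ?sqr_ge0 // andbT; apply: contra_neq cr => V0.
  have /enorm2_eq0[] : enorm2 (v1, v2) = 0 by [].
  rewrite /v1 /v2 => e1 e2.
  transitivity (a.1 * (b.2 - a.2) - a.2 * (b.1 - a.1)); first by ring.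
  by rewrite e1 e2 !mulr0 subrr.
have V0' : V != 0 by rewrite gt_eqF.
pose z : R * R := (C / V * v2, - (C / V * v1)).
have zE : enorm2 z = C ^+ 2 / V by rewrite /enorm2 /z /=; move: V0'; rewrite /V => ?; field.
have za : enorm2 z = a.1 * z.1 + a.2 * z.2.
  by rewrite zE /z /C /v1 /v2 /=; field.
have zb : enorm2 z = b.1 * z.1 + b.2 * z.2.
  by rewrite zE /z /C /v1 /v2 /=; field.
have z0 : 0 < enorm2 z by rewrite zE divr_gt0 // lt0r sqr_ge0 sqrf_eq0 cr.
have Oz : punctured_disc z.
  apply/punctured_discE; rewrite z0 /=; move/punctured_discE : Oa => /andP[_].
  apply: le_lt_trans; rewrite zE ler_pdivrMr // -subr_ge0.
  rewrite (_ : _ - _ = (a.1 * v1 + a.2 * v2) ^+ 2) ?sqr_ge0 //.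
  by rewrite /enorm2 /V /C /v1 /v2; ring.
by rewrite -(circle_const a z) // -(circle_const b z).
Qed.

(** Two linearly independent reference points suffice to reach every x. *)
Lemma radial_of_linear_bound :
  exists2 c, 0 < c & forall x, punctured_disc x -> h x = c * enorm2 x.
Proof.
pose p : R * R := (2^-1, 0); pose q : R * R := (0, 2^-1).
have sp : enorm2 p = 4^-1 by rewrite /enorm2 /=; field.
have sq : enorm2 q = 4^-1 by rewrite /enorm2 /=; field.
have Op : punctured_disc p by apply/punctured_discE; rewrite sp; lra.
have Oq : punctured_disc q by apply/punctured_discE; rewrite sq; lra.
exists (h p / enorm2 p); first by rewrite divr_gt0 ?expR_gt0 // sp.
move=> x Ox; have /punctured_discE/andP[x0 x1] := Ox.
suff <- : h x / enorm2 x = h p / enorm2 p by rewrite divfK ?gt_eqF.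
have [x2|x2] := eqVneq x.2 0; last first.
  apply: independent_const => //; rewrite /= mulr0 sub0r oppr_eq0.
  by apply: mulf_neq0 => //; rewrite invr_eq0.
rewrite (independent_const x q) //; last first.
  rewrite /= mulr0 subr0 mulf_neq0 ?invr_eq0 //.
  by apply: contraTneq x0 => x10; rewrite /enorm2 x10 x2 expr0n addr0 ltxx.
apply: independent_const => //; rewrite /= mul0r sub0r oppr_eq0.
by apply: mulf_neq0; rewrite invr_eq0.
Qed.

End circles.

(** * The function -4 ln |x| *)

Section fundamental_solution.
Context {R : realType}.
Implicit Types (x y : R * R) (P : polyexpr R).

Lemma differentiable_peval P x : differentiable (peval P) x.
Proof.
elim: P => [c|||P IP Q IQ|P IP Q IQ].
- exact: differentiable_cst.
- exact: (@linear_differentiable _ _ _ (GRing.Linear.clone _ _ _ _ (fst : R * R -> R) _) _ continuous_fst).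
- exact: (@linear_differentiable _ _ _ (GRing.Linear.clone _ _ _ _ (snd : R * R -> R) _) _ continuous_snd).
- exact: differentiableD IP IQ.
- exact: differentiableM IP IQ.
Qed.

Lemma is_derive_ln_peval P x i : 0 < peval P x ->
  is_derive x (basis2 i) (fun y => ln (peval P y)) (peval (pderiv i P) x / peval P x).
Proof.
move=> P0.
have dl : derivable (@ln R) (peval P x) 1 by case: (is_derive1_ln P0).
have dln : differentiable (@ln R) (peval P x) by exact/derivable1_diffP.
have dP := differentiable_peval P x.
apply: DeriveDef; first exact/diff_derivable/differentiable_comp.
rewrite (deriveE _ (differentiable_comp dP dln)) (diff_comp dP dln) /=.
rewrite deriv1E // -deriveE // derive_peval derive1E.
by have [_ ->] := is_derive1_ln P0.
Qed.

Lemma conf_hess_fundamental (f : R * R -> R) (C : R) :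
  (forall x, punctured_disc x -> f x = - 4 * ln (enorm x) + C) ->
  forall x, punctured_disc x -> conf_hess f x = 0.
Proof.
move=> fE x Ox.
have pos y : punctured_disc y -> 0 < peval enorm2p y.
  by move=> /punctured_discE; rewrite peval_enorm2p => /andP[].
have nearO y : punctured_disc y -> \forall z \near y, punctured_disc z.
  by move=> Oy; exact: open_nbhs_nbhs (conj open_punctured_disc Oy).
have fE2 y : punctured_disc y -> - 2 * ln (peval enorm2p y) + C = f y.
  move=> Oy; rewrite fE // peval_enorm2p -enorm_sqr lnXn; first by ring.
  by rewrite lt0r enorm_ge0 -sqrf_eq0 enorm_sqr -peval_enorm2p gt_eqF ?pos.
have d1 y i : punctured_disc y ->
    'D_(basis2 i) f y = - 2 * (peval (pderiv i enorm2p) y / peval enorm2p y).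
  move=> Oy; have dl := is_derive_ln_peval enorm2p y i (pos y Oy).
  rewrite -(@near_eq_derive _ _ _ (fun z => - 2 * ln (peval enorm2p z) + C)); last first.
    by apply: filterS (nearO y Oy) => z; exact: fE2.
  have [_ ->] : is_derive y (basis2 i) (fun z => - 2 * ln (peval enorm2p z) + C)
      (- 2 *: (peval (pderiv i enorm2p) y / peval enorm2p y) + 0).
    apply: is_deriveD; exact: (is_deriveZ _ (- 2)).
  by rewrite addr0.
have d2 i j : 'D_(basis2 i) ('D_(basis2 j) f) x =
    - 2 * (peval (pderiv i (pderiv j enorm2p)) x / peval enorm2p x
           - peval (pderiv j enorm2p) x * peval (pderiv i enorm2p) x / peval enorm2p x ^+ 2).
  have Px := pos x Ox.
  rewrite (@near_eq_derive _ _ _ _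
    (fun z => - 2 * (peval (pderiv j enorm2p) z * (peval enorm2p z)^-1))); last first.
    by apply: filterS (nearO x Ox) => z; exact: d1.
  have dj := is_derive_peval (pderiv j enorm2p) i x.
  have dV : is_derive x (basis2 i) (fun z => (peval enorm2p z)^-1)
      (- (peval enorm2p x) ^- 2 *: peval (pderiv i enorm2p) x).
    have dP := is_derive_peval enorm2p i x.
    apply: DeriveDef; first by apply: derivableV; [rewrite gt_eqF|case: dP].
    by rewrite deriveV ?gt_eqF // derive_peval.
  have [_ ->] := is_deriveZ (- 2) (is_deriveM dj dV).
  rewrite /GRing.scale /=; field.
  by rewrite gt_eqF.
have Px := pos x Ox.
have E0 := expR_gt0 (f x).
apply/matrixP => i j; rewrite /conf_hess /hess /grad /sqnorm !mxE big_ord1 !mxE.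
rewrite big_ord_recl big_ord1 !mxE d2 !d1 //.
rewrite (_ : lift ord0 ord0 = 1); last exact/val_inj.
have ij (k : 'I_2) : k = 0 \/ k = 1.
  by case: k => [[|[|//]]] ?; [left|right]; exact/val_inj.
have Px' : x.1 * x.1 + x.2 * x.2 != 0 by rewrite gt_eqF.
have E0' : expR (f x) != 0 by rewrite gt_eqF.
move: (expR (f x)) E0' => E E0'.
by case: (ij i) => ->; case: (ij j) => ->; rewrite /=; field; rewrite E0' Px'.
Qed.

End fundamental_solution.

(** * Lipschitz norms and extension to the origin *)

Section lipschitz_norm.
Context {R : realType}.
Implicit Types (x y z : R * R) (f : R * R -> R) (D : set (R * R)).

Lemma C01_norm_le D f (M La : R) :
  (forall x, D x -> `|f x| <= M) -> 0 <= La ->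
  (forall x y, D x -> D y -> f y - f x <= La * enorm (y - x)) ->
  (C01_norm D f <= (M + La)%:E)%E.
Proof.
move=> fM La0 fL; rewrite /C01_norm EFinD; apply: leeD.
  by apply: ge_ereal_sup => _ [x Dx <-]; rewrite lee_fin fM.
apply: ge_ereal_sup => _ [[x y] [/= Dx Dy] <-]; rewrite lee_fin.
(* On the diagonal the quotient is 0 by convention. *)
have [->|xy] := eqVneq (enorm (x - y)) 0; first by rewrite invr0 mulr0.
have e0 : 0 < enorm (x - y) by rewrite lt0r xy enorm_ge0.
rewrite ler_pdivrMr // ler_norml; apply/andP; split; last exact: fL.
by rewrite lerNl opprB enormB; exact: fL.
Qed.

Lemma lipschitz_of_C01_norm D f : D !=set0 -> (C01_norm D f < +oo)%E ->
  exists2 La : R, 0 <= La &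
    forall x y, D x -> D y -> `|f x - f y| <= La * enorm (x - y).
Proof.
move=> [x0 Dx0]; rewrite /C01_norm.
set S1 := ereal_sup _; set S2 := ereal_sup _ => fin.
have S10 : (0 <= S1)%E.
  apply: (@le_trans _ _ (`|f x0|)%:E); first by rewrite lee_fin.
  by apply: ereal_sup_ubound; exists x0.
have S20 : (0 <= S2)%E.
  apply: ereal_sup_ubound; exists (x0, x0) => //=.
  by rewrite !subrr normr0 mul0r.
have S2oo : (S2 < +oo)%E.
  by apply: le_lt_trans fin; rewrite leeDr.
have S2E : S2 = (fine S2)%:E by rewrite fineK // ge0_fin_numE.
exists (fine S2); first exact: fine_ge0.
move=> x y Dx Dy.
have [xy|xy] := eqVneq (enorm (x - y)) 0.
  have /enorm2_eq0/subr0_eq -> : enorm2 (x - y) = 0 by rewrite -enorm_sqr xy expr0n.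
  by rewrite !subrr normr0 enorm0 mulr0.
rewrite -ler_pdivrMr ?lt0r ?xy ?enorm_ge0 // -lee_fin -S2E.
by apply: ereal_sup_ubound; exists (x, y).
Qed.

Lemma near_enorm_lt x (e : R) : 0 < e -> \forall y \near x, enorm (y - x) < e.
Proof.
move=> e0; pose Q := quadric (enorm2 x) (- 2 * x.1) (- 2 * x.2) 1.
have QE y : peval Q y = enorm2 (y - x) by rewrite /= /enorm2 /=; ring.
have : peval Q x < e ^+ 2 by rewrite QE subrr /enorm2 expr0n addr0 exprn_gt0.
move=> /(near_peval_lt Q); apply: filterS => y; rewrite QE => ye.
by rewrite -ltr_sqr ?nnegrE ?enorm_ge0 ?ltW // enorm_sqr.
Qed.

Lemma continuous0_of_lipschitz f (r La : R) : 0 < r -> 0 <= La ->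
  (forall x, enorm x <= r -> `|f x - f 0| <= La * enorm x) ->
  forall e : R, 0 < e -> \forall x \near (0 : R * R), `|f x - f 0| < e.
Proof.
move=> r0 La0 fL e e0.
have La1 : 0 < La + 1 by rewrite ltr_wpDl.
have d0 : 0 < Num.min r (e / (La + 1)) by rewrite lt_min r0 divr_gt0.
apply: filterS (near_enorm_lt 0 _ d0) => x; rewrite subr0 lt_min => /andP[xr xe].
apply: le_lt_trans (fL x (ltW xr)) _.
move: xe; rewrite ltr_pdivlMr //; have := enorm_ge0 x; nra.
Qed.

Lemma small_point (A : set (R * R)) (e : R) : nbhs (0 : R * R) A -> 0 < e ->
  exists x, [/\ A x, x != 0 & enorm x < e].
Proof.
move=> /nbhs_box[r r0 rA] e0; pose m := Num.min r (e / 2).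
have m0 : 0 < m by rewrite lt_min r0 divr_gt0.
have mr : m <= r by rewrite ge_min lexx.
have me : m <= e / 2 by rewrite ge_min lexx orbT.
exists (m, 0); split.
- by apply: rA; split; rewrite /= in_itv /=; apply/andP; split; lra.
- by apply/eqP => -[] mm; move: m0; rewrite mm ltxx.
- by rewrite /enorm /= expr0n addr0 sqrtr_sqr gtr0_norm //; lra.
Qed.

Lemma lipschitz_extend0 f (r La : R) : 0 < r -> 0 <= La ->
  (forall e : R, 0 < e -> \forall x \near (0 : R * R), `|f x - f 0| < e) ->
  (forall x y, enorm x <= r -> enorm y <= r -> x != 0 -> y != 0 ->
    f y - f x <= La * enorm (y - x)) ->
  forall x y, enorm x <= r -> enorm y <= r -> f y - f x <= La * enorm (y - x).
Proof.
move=> r0 La0 f0 fL.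
have La1 : 0 < La + 1 by rewrite ltr_wpDl.
have small e : 0 < e -> exists z, [/\ `|f z - f 0| < e, z != 0, enorm z <= r &
    La * enorm z <= e].
  move=> e0; have d0 : 0 < Num.min r (e / (La + 1)) by rewrite lt_min r0 divr_gt0.
  have [z [fz z0]] := small_point _ _ (f0 e e0) d0.
  rewrite lt_min => /andP[zr]; rewrite ltr_pdivlMr // => ze.
  exists z; split=> //; first exact: ltW.
  by have := enorm_ge0 z; nra.
move=> x y xr yr.
have [->|x0] := eqVneq x 0; have [->|y0] := eqVneq y 0.
- by rewrite !subrr enorm0 mulr0.
- apply/ler_addgt0Pr => e e0.
  have e20 : 0 < e / 2 by rewrite divr_gt0.
  have [z [fz z0 zr ze]] := small (e / 2) e20.
  have := fL z y zr yr z0 y0; move: fz; rewrite ltr_norml => /andP[fz1 fz2].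
  have : La * enorm (y - z) <= La * (enorm y + enorm z).
    by rewrite ler_wpM2l //; have := enormD y (- z); rewrite enormN.
  by rewrite subr0; lra.
- apply/ler_addgt0Pr => e e0.
  have e20 : 0 < e / 2 by rewrite divr_gt0.
  have [z [fz z0 zr ze]] := small (e / 2) e20.
  have := fL x z xr zr x0 z0; move: fz; rewrite ltr_norml => /andP[fz1 fz2].
  have : La * enorm (z - x) <= La * (enorm z + enorm x).
    by rewrite ler_wpM2l //; have := enormD z (- x); rewrite enormN.
  by rewrite sub0r enormN; lra.
- exact: fL.
Qed.

Lemma ln_lipschitz (m a b : R) : 0 < m -> m <= a -> m <= b ->
  ln b - ln a <= `|b - a| / m.
Proof.
move=> m0 ma mb.
have a0 : 0 < a by exact: lt_le_trans ma.
have b0 : 0 < b by exact: lt_le_trans mb.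
rewrite -ln_div ?posrE //.
have := expR_ge1Dx (ln (b / a)); rewrite lnK ?posrE ?divr_gt0 // => H.
have -> : ln (b / a) = 1 + ln (b / a) - 1 by ring.
apply: (@le_trans _ _ (b / a - 1)); first by lra.
rewrite (_ : b / a - 1 = (b - a) / a); last by field; rewrite gt_eqF.
rewrite ler_pdivrMr // mulrAC ler_pdivlMr //.
by have := ler_norm (b - a); have := normr_ge0 (b - a); nra.
Qed.

End lipschitz_norm.

(** * The two alternatives *)

Section extension.
Context {R : realType} (u : R * R -> \bar R) (su : supersolution u).
Local Notation w := (profile u).
Implicit Types (x y z : R * R).

Lemma profile_le x y : (w x <= w y) = (sq_profile u x <= sq_profile u y).
Proof. by rewrite /profile /sq_profile !ler_expR; apply/idP/idP; lra. Qed.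

Lemma profile_max_sphere (r : R) : 0 < r -> r < 1 ->
  exists2 x, enorm2 x = r ^+ 2 & forall y, enorm2 y = r ^+ 2 -> w y <= w x.
Proof.
move=> r0 r1; pose S := [set x | r ^+ 2 <= peval enorm2p x] `&` [set x | peval enorm2p x <= r ^+ 2].
have SE x : S x <-> enorm2 x = r ^+ 2.
  rewrite /S /setI /mkset peval_enorm2p; split=> [[a b]|->]; last by [].
  by apply/eqP; rewrite eq_le a b.
have r2 : 0 < r ^+ 2 < 1 by rewrite exprn_gt0 // exprn_ilt1 // ltW.
have cS : compact S.
  apply: compact_subdisc; first by apply: closedI; [exact: closed_peval_ge|exact: closed_peval_le].
  by move=> x /SE ->; case/andP: r2 => _ /ltW.
have S0 : S !=set0.
  by exists (r, 0); apply/SE; rewrite /enorm2 expr0n addr0.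
have [|x /SE xS xh] := usc_argmax _ S (sq_profile u) cS S0.
  move=> x t /SE xS ht; have Ox : punctured_disc x by apply/punctured_discE; rewrite xS.
  apply: filterS (sq_profile_usc u su x t Ox ht) => y hy /SE yS.
  by apply: hy; apply/punctured_discE; rewrite yS.
by exists x => // y /SE yS; rewrite profile_le; exact: xh.
Qed.

Lemma enorm2_lt1 x (r : R) : enorm x <= r -> r < 1 -> enorm2 x < 1.
Proof.
move=> xr r1; rewrite -enorm_sqr expr_lt1 ?enorm_ge0 //; exact: le_lt_trans r1.
Qed.

Lemma profile_lipschitz (r r' M : R) x y : 0 < r -> r < r' -> r' < 1 ->
  (forall z, enorm2 z = r' ^+ 2 -> w z <= M) ->
  enorm x <= r -> enorm y <= r -> x != 0 -> y != 0 ->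
  w y - w x <= M / (r' - r) * enorm (y - x).
Proof.
move=> r0 rr r1 wM xr yr x0 y0.
apply: (lipschitz_punctured w r r' M) => //; first exact: profile_convex_off0.
by move=> z; apply: ltW; exact: profile_gt0.
Qed.

Lemma profile_le_sphere (r M : R) x : 0 < r -> r < 1 ->
  (forall z, enorm2 z = r ^+ 2 -> w z <= M) -> enorm x <= r -> x != 0 -> w x <= M.
Proof.
move=> r0 r1 wM xr x0; apply: (convex_le_sphere w r M x) => //.
- exact: profile_convex_off0.
- exact: enorm2_gt0.
- by rewrite -enorm_le // ltW.
Qed.

(** On the disc of radius 1/2 the profile is at most its maximum over the circle
    of radius 3/4, and has Lipschitz constant 1 / (3/4 - 1/2) = 4 times this
    maximum.  Both bounds extend to the origin by continuity of v. *)
Lemma interior_estimate (v : R * R -> R) : C01_extension u v ->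
  let W := fun x => expR (- v x / 4) in
  exists2 x0, esphere (3 / 4) x0 &
    (forall x, esphere (3 / 4) x -> W x <= W x0) /\
    (C01_norm (eball (1 / 2)) W <= (5 * W x0)%:E)%E.
Proof.
move=> [vloc uv] W.
have WE x : punctured_disc x -> W x = w x by move=> Ox; rewrite /W /profile uv.
have q0 : (0 : R) < 3 / 4 by lra.
have q1 : (3 / 4 : R) < 1 by lra.
have sphE x : esphere (3 / 4) x <-> enorm2 x = (3 / 4) ^+ 2.
  rewrite /esphere /mkset -enorm_sqr; split=> [->//|/eqP].
  by rewrite eqrXn2 ?enorm_ge0 // ?(ltW q0) // => /eqP.
have sphO x : enorm2 x = (3 / 4) ^+ 2 -> punctured_disc x.
  by move=> xS; apply/punctured_discE; rewrite xS; apply/andP; split; lra.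
have [x0 x0S x0M] := profile_max_sphere _ q0 q1.
exists x0; first exact/sphE.
split=> [x /sphE xS|]; first by rewrite !WE //; [exact: x0M|exact: sphO|exact: sphO].
have Wx0 : W x0 = w x0 by rewrite WE //; exact: sphO.
have M0 : 0 < w x0 by exact: profile_gt0.
rewrite Wx0 (_ : 5 * w x0 = w x0 + 4 * w x0); last by ring.
pose K := [set x : R * R | peval enorm2p x <= 4^-1].
have cK : compact K.
  apply: compact_subdisc; first exact: closed_peval_le.
  by move=> x; rewrite /K /mkset peval_enorm2p => xK; lra.
have KE x : K x <-> enorm x <= 1 / 2.
  rewrite /K /mkset peval_enorm2p enorm_le; last by lra.
  by rewrite (_ : (1 / 2) ^+ 2 = 4^-1 :> R) //; field.
have K1 : K `<=` eball 1.
  by move=> x /KE; rewrite /eball /= => xK; apply: le_lt_trans xK _; lra.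
have K0 : K 0 by apply/KE; rewrite enorm0; lra.
have [|La La0 vL] := lipschitz_of_C01_norm K v (ex_intro _ 0 K0); first exact: vloc.
have v_cont : forall e : R, 0 < e -> \forall x \near (0 : R * R), `|v x - v 0| < e.
  apply: (continuous0_of_lipschitz v (1 / 2) La) => //.
  by move=> x /KE xK; have := vL x 0 xK K0; rewrite subr0.
have W_cont : forall e : R, 0 < e -> \forall x \near (0 : R * R), `|W x - W 0| < e.
  have cv : v x @[x --> (0 : R * R)] --> v 0.
    apply/cvgrPdist_lt => e e0; apply: filterS (v_cont e e0) => x.
    by rewrite distrC.
  have cW : W x @[x --> (0 : R * R)] --> W 0.
    apply: (@continuous_cvg _ _ _ _ _ _ (fun t : R => expR (- t / 4))) cv.
    apply: (@continuous_comp _ _ _ (fun t : R => - t / 4) expR).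
      by apply: cvgMl; apply: cvgN; exact: cvg_id.
    exact: continuous_expR.
  move=> e e0; have /cvgrPdist_lt/(_ e e0) := cW; apply: filterS => x.
  by rewrite distrC.
have Oball x : enorm x <= 1 / 2 -> x != 0 -> punctured_disc x.
  move=> xr xn; apply/punctured_discE; rewrite enorm2_gt0 //=.
  by apply: enorm2_lt1 xr _; lra.
apply: C01_norm_le; [|by lra|].
- move=> x; rewrite /eball /= => /ltW xr; rewrite ger0_norm ?expR_ge0 //.
  have WM z : enorm z <= 1 / 2 -> z != 0 -> W z <= w x0.
    move=> zr zn; rewrite WE; last exact: Oball.
    by apply: (profile_le_sphere (3 / 4)) => //; lra.
  have [->|xn] := eqVneq x 0; last exact: WM.
  apply/ler_addgt0Pr => e e0.
  have h0 : 0 < 1 / 2 :> R by lra.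
  have [z [Wz zn zr]] := small_point _ _ (W_cont e e0) h0.
  have := WM z (ltW zr) zn; move: Wz; rewrite ltr_norml => /andP[].
  by lra.
- move=> x y; rewrite /eball /= => /ltW xr /ltW yr.
  apply: (lipschitz_extend0 W (1 / 2)) => //; try lra.
  move=> {xr yr}x {}y xr yr xn yn; rewrite !WE; try exact: Oball.
  have -> : 4 * w x0 = w x0 / (3 / 4 - 1 / 2) by field.
  by apply: profile_lipschitz => //; lra.
Qed.

End extension.

Section dichotomy.
Context {R : realType} (u : R * R -> \bar R) (su : supersolution u).
Local Notation w := (profile u).
Implicit Types (x y z : R * R).

(** The value is the McShane extension sup (w x - La |x|): the Lipschitz
    bound away from the origin gives both inequalities without a limit. *)
Lemma value_at_puncture : exists2 w0 : R, 0 <= w0 &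
  exists2 La : R, 0 < La &
    forall x, enorm x <= 1 / 2 -> x != 0 -> `|w x - w0| <= La * enorm x.
Proof.
have q0 : (0 : R) < 3 / 4 by lra.
have q1 : (3 / 4 : R) < 1 by lra.
have [x0 x0S x0M] := profile_max_sphere u su _ q0 q1.
pose La := 4 * w x0.
have La0 : 0 < La by rewrite mulr_gt0 // profile_gt0.
have wL x y : enorm x <= 1 / 2 -> enorm y <= 1 / 2 -> x != 0 -> y != 0 ->
    w y - w x <= La * enorm (y - x).
  move=> xr yr xn yn.
  have -> : La = w x0 / (3 / 4 - 1 / 2) by rewrite /La; field.
  by apply: profile_lipschitz => //; lra.
pose S := [set w x - La * enorm x | x in [set x | enorm x <= 1 / 2 /\ x != 0]].
have wS x : enorm x <= 1 / 2 -> x != 0 -> ubound S (w x + La * enorm x).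
  move=> xr xn _ [y [yr yn] <-].
  have : La * enorm (y - x) <= La * (enorm y + enorm x).
    by rewrite ler_wpM2l ?(ltW La0) //; have := enormD y (- x); rewrite enormN.
  by have := wL x y xr yr xn yn; lra.
pose p : R * R := (1 / 2, 0).
have pr : enorm p <= 1 / 2.
  by rewrite /enorm /= expr0n addr0 sqrtr_sqr ger0_norm //; lra.
have pn : p != 0 by apply/eqP => -[]; lra.
have supS : has_sup S.
  by split; [exists (w p - La * enorm p); exists p|exists (w p + La * enorm p); exact: wS].
have up x : enorm x <= 1 / 2 -> x != 0 -> w x - La * enorm x <= sup S.
  by move=> xr xn; apply: (ub_le_sup (proj2 supS)); exists x.
have low x : enorm x <= 1 / 2 -> x != 0 -> sup S <= w x + La * enorm x.
  by move=> xr xn; apply: (ge_sup (proj1 supS)); exact: wS.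
exists (sup S).
  rewrite leNgt; apply/negP => neg.
  have d0 : 0 < Num.min (1 / 2) (- sup S / La).
    by rewrite lt_min; apply/andP; split; [lra|rewrite divr_gt0 // oppr_gt0].
  have [z [_ zn]] := small_point _ _ filterT d0.
  rewrite lt_min => /andP[zr]; rewrite ltr_pdivlMr // => ze.
  by have := up z (ltW zr) zn; have := profile_gt0 u z; lra.
exists La => // x xr xn; rewrite ler_norml.
by have := up x xr xn; have := low x xr xn; lra.
Qed.

(** On a compact set the extended profile is Lipschitz and bounded below by a
    positive constant, and ln is Lipschitz there. *)
Lemma C01_extension_of_positive (w0 La : R) : 0 < w0 -> 0 < La ->
  (forall x, enorm x <= 1 / 2 -> x != 0 -> `|w x - w0| <= La * enorm x) ->
  exists v : R * R -> R, C01_extension u v.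
Proof.
move=> w00 La0 wL; pose W x := if x == 0 then w0 else w x.
have W0 x : 0 < W x by rewrite /W; case: ifP => // _; exact: profile_gt0.
have WE x : x != 0 -> W x = w x by rewrite /W => /negbTE ->.
have W_cont : forall e : R, 0 < e -> \forall x \near (0 : R * R), `|W x - W 0| < e.
  apply: (continuous0_of_lipschitz W (1 / 2) La); [lra|exact: ltW|].
  move=> x xr; rewrite {2}/W eqxx; have [->|xn] := eqVneq x 0.
    by rewrite /W eqxx subrr normr0 enorm0 mulr0.
  by rewrite WE //; exact: wL.
exists (fun x => - 4 * ln (W x)); split; last first.
  move=> x Ox; rewrite WE; last by case: Ox => _ /= /eqP.
  by rewrite /profile expRK -(supersol_fineK u su x Ox); congr _%:E; field.
move=> K cK K1.
have [K0|/set0P K0] := eqVneq K set0.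
  apply: le_lt_trans (C01_norm_le K _ 0 0 _ _ _) (ltry _) => //.
    by move=> x; rewrite K0.
  by move=> x y; rewrite K0.
have usc_ev (P : polyexpr R) x t : K x -> peval P x < t -> \forall y \near x, K y -> peval P y < t.
  by move=> _ /(near_peval_lt P); apply: filterS.
have [xm Kxm xmM] := usc_argmax _ K (peval enorm2p) cK K0 (usc_ev enorm2p).
pose r := Num.max (enorm xm) (1 / 2); pose r' := (1 + r) / 2.
have r1 : r < 1 by rewrite gt_max; apply/andP; split; [exact: K1|lra].
have r2 : 1 / 2 <= r by rewrite le_max lexx orbT.
have Kr x : K x -> enorm x <= r.
  move=> /xmM; rewrite !peval_enorm2p => xM; rewrite le_max; apply/orP; left.
  by rewrite enorm_le ?enorm_ge0 // enorm_sqr.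
have r'0 : 0 < r' by rewrite /r'; lra.
have r'1 : r' < 1 by rewrite /r'; lra.
have rr' : r < r' by rewrite /r'; lra.
have [z zS zM] := profile_max_sphere u su _ r'0 r'1.
pose L := w z / (r' - r).
have L0 : 0 <= L by rewrite divr_ge0 ?subr_ge0 ?ltW // profile_gt0.
have WL x y : enorm x <= r -> enorm y <= r -> W y - W x <= L * enorm (y - x).
  apply: (lipschitz_extend0 W r L) => //; first by lra.
  move=> {}x {}y xr yr xn yn; rewrite !WE //.
  by apply: profile_lipschitz => //; lra.
have WLn x y : K x -> K y -> `|W y - W x| <= L * enorm (y - x).
  move=> /Kr xr /Kr yr; rewrite ler_norml WL // andbT lerNl opprB enormB.
  exact: WL.
have L1 : 0 < L + 1 by rewrite ltr_wpDl.
have [a Ka aM] : exists2 a, K a & forall y, K y -> W a <= W y.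
  have [|a Ka aM] := usc_argmax _ K (fun x => - W x) cK K0.
    move=> x t Kx xt; have d0 : 0 < (t + W x) / (L + 1) by rewrite divr_gt0 //; lra.
    apply: filterS (near_enorm_lt x _ d0) => y yx Ky.
    move: yx; rewrite ltr_pdivlMr //.
    have := WL y x (Kr y Ky) (Kr x Kx); rewrite enormB.
    by have := enorm_ge0 (y - x); nra.
  by exists a => // y /aM; rewrite lerN2.
pose Lv := 4 * (L / W a).
have Lv0 : 0 <= Lv by rewrite mulr_ge0 // divr_ge0 // ltW.
have vL x y : K x -> K y -> - 4 * ln (W y) - - 4 * ln (W x) <= Lv * enorm (y - x).
  move=> Kx Ky; have := ln_lipschitz (W a) (W y) (W x) (W0 a) (aM y Ky) (aM x Kx).
  have : `|W x - W y| / W a <= L * enorm (y - x) / W a.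
    by rewrite ler_pM2r ?invr_gt0 // enormB; exact: WLn.
  by rewrite /Lv -!mulrA [enorm _ / _]mulrC; lra.
have := C01_norm_le K (fun x => - 4 * ln (W x)) (`|- 4 * ln (W a)| + Lv * 2) Lv.
move=> /(_ _ Lv0 vL) H; apply: le_lt_trans (H _) (ltry _) => x Kx.
have e2 : Lv * enorm (x - a) <= Lv * 2.
  rewrite ler_wpM2l //; have := enormD x (- a); rewrite enormN.
  by have := Kr x Kx; have := Kr a Ka; lra.
have := vL a x Ka Kx; have := vL x a Kx Ka; rewrite enormB ler_norml.
have := ler_norm (- 4 * ln (W a)); have := ler_norm (- (- 4 * ln (W a))).
rewrite normrN => *; apply/andP; split; lra.
Qed.

Lemma fundamental_of_zero (La : R) : 0 < La ->
  (forall x, enorm x <= 1 / 2 -> x != 0 -> w x <= La * enorm x) ->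
  exists C : R, forall x, punctured_disc x -> u x = (- 4 * ln (enorm x) + C)%:E.
Proof.
move=> La0 wL.
have [|x Ox xr|c c0 hE] := radial_of_linear_bound u su (La ^+ 2).
- exact: exprn_gt0.
- have xn : x != 0 by case: Ox => _ /= /eqP.
  have xe : enorm x <= 1 / 2.
    rewrite enorm_le; last by lra.
    by rewrite (_ : (1 / 2) ^+ 2 = 4^-1 :> R) //; field.
  rewrite -profile_sqr -enorm_sqr -exprMn ler_sqr ?nnegrE ?wL //.
    by rewrite ltW // profile_gt0.
  by rewrite mulr_ge0 ?enorm_ge0 // ltW.
exists (- 2 * ln c) => x Ox; rewrite (supersol_ln u su x Ox) hE //.
have /punctured_discE/andP[x0 _] := Ox.
have e0 : 0 < enorm x by rewrite lt0r enorm_ge0 -sqrf_eq0 enorm_sqr gt_eqF.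
rewrite lnM ?posrE // -enorm_sqr lnXn //; congr _%:E; ring.
Qed.

End dichotomy.

Theorem theorem1p14 (R : realType) :
  exists K : R,
  forall u : R * R -> \bar R,
    LSC punctured_disc u ->
    Linfty_loc punctured_disc u ->
    visc_supersol Gamma2 punctured_disc u ->
    ((exists v : R * R -> R, C01_extension u v) \/
     (exists C : R, forall x, punctured_disc x ->
        u x = (- 4 * ln (enorm x) + C)%:E /\
        conf_hess (fine \o u) x = 0)) /\
    (forall v : R * R -> R, C01_extension u v ->
       let w := fun x => expR (- v x / 4) in
       exists2 x0, esphere (3 / 4) x0 &
         (forall x, esphere (3 / 4) x -> w x <= w x0) /\
         (C01_norm (eball (1 / 2)) w <= (K * w x0)%:E)%E).
Proof.
exists 5 => u lscu Lu usup.
have su : supersolution u by split.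
split; last by move=> v; exact: interior_estimate.
have [w0 w00 [La La0 wL]] := value_at_puncture u su.
have [w0E|w0n] := eqVneq w0 0; last first.
  by left; apply: (C01_extension_of_positive u su w0 La) => //; rewrite lt0r w0n.
right; have [|C uE] := fundamental_of_zero u su La La0.
  by move=> x xr xn; have := wL x xr xn; rewrite w0E subr0; apply: le_trans; exact: ler_norm.
exists C => x Ox; split; first exact: uE.
apply: (conf_hess_fundamental _ C) => // y Oy.
by rewrite /= uE.
Qed.
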